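(* Let $f\colon\mathbb{R}^d\to\mathbb{R}\cup\{\infty\}$ be a closed and $\rho$-weakly convex function, not identically $+\infty$, satisfying the strict saddle property. Choose a constant $\mu\in(0,\rho^{-1})$ and a damping parameter $\alpha\in(0,\min\{1,(\mu\rho)^{-1}-1\})$, and consider the algorithm $$x_{k+1}=(1-\alpha)x_k+\alpha\cdot\mathrm{prox}_{\mu f}(x_k),\qquad k\ge0.$$ Then for (Lebesgue) almost all initializers $x_0\in\mathbb{R}^d$ the following holds: if the limit of $\{x_k\}_{k\ge0}$ exists, it must be a local minimizer of $f$.
   Context: A function $f\colon\mathbb{R}^d\to\mathbb{R}\cup\{\infty\}$ is closed if its epigraph is closed; it is $\rho$-weakly convex ($\rho>0$) if $x\mapsto f(x)+\frac{\rho}{2}\|x\|^2$ is convex, and weakly convex if it is $\rho$-weakly convex for some $\rho>0$. The proximal map is $\mathrm{prox}_{\mu f}(x)=\mathrm{argmin}_y\{f(y)+\frac1{2\mu}\|y-x\|^2\}$. Subdifferential: if $f(\bar x)$ is finite, $\partial f(\bar x)$ is the set of $v$ with $f(x)\ge f(\bar x)+\langle v,x-\bar x\rangle+o(\|x-\bar x\|)$ as $x\to\bar x$; $\partial f(\bar x)=\emptyset$ if $f(\bar x)=\infty$. A point $\bar x$ is critical for $f$ if $0\in\partial f(\bar x)$. Manifolds: $\mathcal{M}\subset\mathbb{R}^d$ is a $C^p$ manifold of dimension $r$ around $\bar x\in\mathcal{M}$ if there are an open neighborhood $U$ of $\bar x$ and a $C^p$ map $G\colon\mathbb{R}^d\to\mathbb{R}^{d-r}$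 with $\nabla G(\bar x)$ of full rank and $\mathcal{M}\cap U=\{x\in U:G(x)=0\}$. The tangent space is $T_{\mathcal{M}}(\bar x)=\ker\nabla G(\bar x)$. Active manifold: for a closed weakly convex $f$ with critical point $\bar x$, a set $\mathcal{M}\ni\bar x$ is an active $C^p$ manifold around (at) $\bar x$ if there is a neighborhood $U$ of $\bar x$ such that (smoothness) $\mathcal{M}\cap U$ is a $C^p$-smooth manifold and the restriction of $f$ to $\mathcal{M}\cap U$ is $C^p$-smooth; (sharpness) $\inf\{\|v\|:v\in\partial f(x),\ x\in U\setminus\mathcal{M}\}>0$ (with $\inf\emptyset=+\infty$). Second-order variation: $f_{\mathcal{M}}:=f+\delta_{\mathcal{M}}$, where $\delta_{\mathcal M}$ is $0$ on $\mathcal M$ and $+\infty$ off it. If $\mathcal{M}$ is an active $C^2$ manifold at the critical point $\bar x$ and $u\in T_{\mathcal{M}}(\bar x)$, then $d^2f_{\mathcal{M}}(\bar x)(u)$ denotes the parabolic subderivative $\liminf_{t\searrow0,\,w'\to w}\frac{f_{\mathcal{M}}(\bar x+tu+\frac12t^2w')-f_{\mathcal{M}}(\bar x)}{\frac12t^2}$, whose value is the same for all $w$ for which it is finite. Equivalently, if $F$ is a $C^2$ function agreeing with $f$ on $\mathcal{M}$ near $\bar x$, $G=0$ are local defining equations of $\mathcal{M}$, and $\bar\lambda$ is the unique multiplier with $\nabla F(\bar x)+\sum_i\bar\lambda_i\nabla G_i(\bar x)=0$, then $d^2f_{\mathcal{M}}(\bar x)(u)=\langle(\nabla^2F(\bar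 x)+\sum_i\bar\lambda_i\nabla^2G_i(\bar x))u,u\rangle$. Strict saddles: a critical point $\bar x$ of a weakly convex $f$ is a strict saddle if there is a $C^2$ active manifold $\mathcal{M}$ of $f$ at $\bar x$ and $d^2f_{\mathcal{M}}(\bar x)(u)<0$ for some $u\in T_{\mathcal{M}}(\bar x)$. The function $f$ has the strict saddle property if each of its critical points is either a local minimizer or a strict saddle. *)

(* Defs.v *)
From HB Require Import structures.
From mathcomp Require Import all_boot all_order all_algebra.
From mathcomp Require Import all_classical all_reals all_analysis.

Set Implicit Arguments.
Unset Strict Implicit.
Unset Printing Implicit Defensive.

Import Order.TTheory GRing.Theory Num.Theory.
Import numFieldNormedType.Exports.

Local Open Scope classical_set_scope.
Local Open Scope ring_scope.

(* Points of R^d are row vectors.  The library norm `|x| on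
   'rV[R]_d is the sup norm: it is used only for the topology and for
   differentiability, which do not depend on the choice of the norm.  The
   Euclidean structure is given by [dot] and [enorm]. *)

Section Euclidean.
Context {R : realType} {d : nat}.
Implicit Types u v : 'rV[R]_d.

Definition dot u v : R := \sum_(i < d) u 0 i * v 0 i.
Definition enorm u : R := Num.sqrt (dot u u).

End Euclidean.

Section LebesgueNull.
Context {R : realType} {d : nat}.

Definition box (a b : 'rV[R]_d) : set 'rV[R]_d :=
  [set x | forall i, a 0 i <= x 0 i <= b 0 i].

Definition box_volume (a b : 'rV[R]_d) : R := \prod_(i < d) (b 0 i - a 0 i).

(* The library has no Lebesgue measure on R^d.  The coverings are indexed by a
   subset D of nat, so that they may be finite or empty: for d = 0 every box has
   volume 1. *)
Definition lebesgue_null (A : set 'rV[R]_d) : Prop :=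
  forall e : R, 0 < e ->
  exists (D : set nat) (a b : nat -> 'rV[R]_d),
    [/\ forall k i, a k 0 i <= b k 0 i,
        A `<=` \bigcup_(k in D) box (a k) (b k) &
        (\esum_(k in D) (box_volume (a k) (b k))%:E <= e%:E)%E].

Definition lebesgue_almost_all (P : 'rV[R]_d -> Prop) : Prop :=
  lebesgue_null [set x | ~ P x].

End LebesgueNull.

(* An extended-valued f : R^d -> R \cup {+oo} is a map to \bar R that avoids
   -oo; this is a separate hypothesis of the theorem. *)
Section ExtendedValued.
Context {R : realType} {d : nat}.
Implicit Types f g : 'rV[R]_d -> \bar R.

Definition closed_epigraph f : Prop :=
  closed [set z : 'rV[R]_d * R | (f z.1 <= z.2%:E)%E].

Definition econvex g : Prop :=
  forall (x y : 'rV[R]_d) (t : R), 0 < t < 1 ->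
  (g (t *: x + (1 - t) *: y)%R <= t%:E * g x + (1 - t)%:E * g y)%E.

Definition weakly_convex (rho : R) f : Prop :=
  econvex (fun x => f x + (rho / 2 * enorm x ^+ 2)%:E)%E.

Definition prox_objective (mu : R) f (x y : 'rV[R]_d) : \bar R :=
  (f y + ((2 * mu)^-1 * enorm (y - x) ^+ 2)%:E)%E.

Definition prox_set (mu : R) f (x : 'rV[R]_d) : set 'rV[R]_d :=
  [set y | forall z, (prox_objective mu f x y <= prox_objective mu f x z)%E].

(* The default value x is irrelevant: if f is closed, proper and rho-weakly
   convex and 0 < mu < 1 / rho, then prox_set mu f x is a singleton. *)
Definition prox (mu : R) f (x : 'rV[R]_d) : 'rV[R]_d := xget x (prox_set mu f x).

Definition damped_prox_iter (mu alpha : R) f (x0 : 'rV[R]_d) (k : nat) :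
    'rV[R]_d :=
  iter k (fun x => (1 - alpha) *: x + alpha *: prox mu f x) x0.

Definition local_minimizer f (x : 'rV[R]_d) : Prop :=
  f x \is a fin_num /\ \forall y \near x, (f x <= f y)%E.

Definition subdifferential f (x : 'rV[R]_d) : set 'rV[R]_d :=
  [set v | f x \is a fin_num /\
    forall e : R, 0 < e ->
      \forall y \near x,
        (f x + (dot v (y - x) - e * enorm (y - x))%:E <= f y)%E].

Definition critical f (x : 'rV[R]_d) : Prop := subdifferential f x 0.

End ExtendedValued.

Section Smooth.
Context {R : realType} {d : nat}.

(* C^p on an open set U *)
Fixpoint Cp_on (W : normedModType R) (p : nat) (U : set 'rV[R]_d)
    (g : 'rV[R]_d -> W) : Prop :=
  if p is q.+1 then
    (forall x, U x -> differentiable g x) /\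
    (forall v : 'rV[R]_d, Cp_on q U ('D_v g))
  else forall x, U x -> {for x, continuous g}.

Definition local_equations (p r : nat) (M : set 'rV[R]_d) (x : 'rV[R]_d)
    (U : set 'rV[R]_d) (G : 'rV[R]_d -> 'rV[R]_(d - r)) : Prop :=
  [/\ (r <= d)%N, open_nbhs x U, Cp_on p setT G,
      \rank (jacobian G x) = (d - r)%N &
      M `&` U = [set y | U y /\ G y = 0]].

Definition manifold_around (p r : nat) (M : set 'rV[R]_d) (x : 'rV[R]_d) :
    Prop :=
  M x /\ exists U G, @local_equations p r M x U G.

Definition manifold (p r : nat) (M : set 'rV[R]_d) : Prop :=
  forall x, M x -> manifold_around p r M x.

(* The kernel of the differential does not depend on the C^p local equations
   (1 <= p). *)
Definition tangent_space (p : nat) (M : set 'rV[R]_d) (x : 'rV[R]_d) :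
    set 'rV[R]_d :=
  [set u | exists r U G, @local_equations p r M x U G /\ 'd G x u = 0].

Definition Cp_restriction (p : nat) (f : 'rV[R]_d -> \bar R)
    (M : set 'rV[R]_d) : Prop :=
  forall x, M x -> exists (V : set 'rV[R]_d) (F : 'rV[R]_d -> R),
    [/\ open_nbhs x V, Cp_on p V (F : 'rV[R]_d -> R^o) &
        forall y, M y -> V y -> f y = (F y)%:E].

Definition active_manifold (p : nat) (f : 'rV[R]_d -> \bar R)
    (M : set 'rV[R]_d) (x : 'rV[R]_d) : Prop :=
  M x /\ exists U : set 'rV[R]_d,
    [/\ open_nbhs x U,
        exists r, manifold p r (M `&` U),
        Cp_restriction p f (M `&` U) &
        (0 < ereal_inf [set (enorm v)%:E | v in
               \bigcup_(y in U `\` M) subdifferential f y])%E].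

Definition restrict_to (f : 'rV[R]_d -> \bar R) (M : set 'rV[R]_d)
    (x : 'rV[R]_d) : \bar R :=
  (f x + (if x \in M then 0 else +oo))%E.

Definition parabolic_subderivative (g : 'rV[R]_d -> \bar R)
    (x u w : 'rV[R]_d) : \bar R :=
  limf_einf (fun tw : R * 'rV[R]_d =>
      ((g (x + tw.1 *: u + (tw.1 ^+ 2 / 2) *: tw.2)%R - g x)
        * ((tw.1 ^+ 2 / 2)^-1)%:E)%E)
    (filter_prod 0^'+ (nbhs w)).

(* d2_restricted f M x u c : the second-order variation of f_M at x along u is
   c, i.e. c is the common value of the finite parabolic subderivatives. *)
Definition d2_restricted (f : 'rV[R]_d -> \bar R) (M : set 'rV[R]_d)
    (x u : 'rV[R]_d) (c : R) : Prop :=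
  exists w, parabolic_subderivative (restrict_to f M) x u w = c%:E.

Definition strict_saddle (f : 'rV[R]_d -> \bar R) (x : 'rV[R]_d) : Prop :=
  critical f x /\
  exists M : set 'rV[R]_d, active_manifold 2 f M x /\
  exists u c, [/\ tangent_space 2 M x u, d2_restricted f M x u c & c < 0].

Definition strict_saddle_property (f : 'rV[R]_d -> \bar R) : Prop :=
  forall x, critical f x -> local_minimizer f x \/ strict_saddle f x.

End Smooth.

(* Main.v *)
(** The damped proximal map T x = (1 - alpha) x + alpha prox x expands
    distances by a factor bounded below, because prox is monotone; hence
    preimages of null sets under T are null.  A limit of the iterates is a
    fixed point of T, hence critical, so by Lindelöf it suffices to show that
    the set of points whose orbit stays near a given strict saddle is null.

    Near a strict saddle, sharpness forces prox x into the active manifold,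
    where prox x minimizes a C^2 function under C^2 equality constraints.
    Subtracting the Lagrange conditions at two points gives a linear KKT system
    up to a small relative error.  The KKT matrix turns out to be invertible,
    so prox is strictly differentiable at the saddle, with a symmetric positive
    semidefinite derivative B, and a direction of negative curvature u
    satisfies <u B, u> > <u, u>.  Multipliers are obtained by a quadratic
    penalty and the invertibility of the KKT matrix from the solvability of the
    perturbed systems, so no parametrization of the manifold is needed.

    Let A be the derivative of T.  Choose beta > 1, not an eigenvalue of A,
    with <u A, u> > beta <u, u>.  The quadratic form Q w = <w (A - beta), w>
    satisfies Q (w A) >= beta^2 Q w + delta |w|^2.  Hence Q (x - y) <= 0 for
    any two points x and y whose orbits stay near the saddle, while Q u > 0: on
    the set of such points a projection along u onto a coordinate hyperplane is
    injective with a Lipschitz inverse, so this set is null. *)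

Require Import Defs.
From mathcomp Require Import all_boot all_order all_algebra.
From mathcomp Require Import all_classical all_reals all_analysis.
From mathcomp Require Import ring lra.
Import Order.TTheory GRing.Theory Num.Theory.
Import numFieldNormedType.Exports.
Local Open Scope classical_set_scope.
Local Open Scope ring_scope.

Set Implicit Arguments.
Unset Strict Implicit.
Unset Printing Implicit Defensive.

(** * Null sets *)

Section NullSets.
Context {R : realType} {d : nat}.
Implicit Types (A : set 'rV[R]_d) (x y c : 'rV[R]_d) (v : \bar R).

Lemma rV_norm_coord n (x : 'rV[R]_n) i : `|x 0 i| <= `|x|.
Proof.
rewrite [leRHS]/Num.norm /= mx_normrE; apply/bigmax_geP; right => /=.
by exists (0, i).
Qed.

Lemma rV_norm_leP n (x : 'rV[R]_n) (s : R) :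
  0 <= s -> reflect (forall i, `|x 0 i| <= s) (`|x| <= s).
Proof.
move=> s0; apply: (iffP idP) => [xs i|xs].
  exact: le_trans (rV_norm_coord x i) xs.
rewrite [leLHS]/Num.norm /= mx_normrE; apply/bigmax_leP; split=> // -[i j] _ /=.
by rewrite ord1.
Qed.

Definition cube c (s : R) : set 'rV[R]_d := [set x | `|x - c| <= s].

(** Cubes are balls of the sup norm, which an expanding map pulls back into balls; so coverings by
    boxes are first turned into coverings by cubes. The bound [v] is extended-valued so that it can
    be a countable sum of bounds. *)
Definition cube_cover A v : Prop :=
  exists (D : set nat) (c : nat -> 'rV[R]_d) (s : nat -> R),
    [/\ forall k, 0 <= s k, A `<=` \bigcup_(k in D) cube (c k) (s k) &
        (\esum_(k in D) ((2 * s k) ^+ d)%:E <= v)%E].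

Lemma cube_cover_count (I : countType) (D : set I) (c : I -> 'rV[R]_d)
    (s : I -> R) A v :
  (forall i, 0 <= s i) -> A `<=` \bigcup_(i in D) cube (c i) (s i) ->
  (\esum_(i in D) ((2 * s i) ^+ d)%:E <= v)%E -> cube_cover A v.
Proof.
move=> s0 Ac sv.
pose c' n := if unpickle n is Some i then c i else 0.
pose s' n := if unpickle n is Some i then s i else 0.
exists (pickle @` D), c', s'; split.
- by move=> k; rewrite /s'; case: unpickle => // a.
- move=> x /Ac[i Di xi]; exists (pickle i); first by exists i.
  by rewrite /cube /= /c' /s' pickleK.
- rewrite esum_image; last by move=> i j _ _ /(pcan_inj pickleK).
  apply: le_trans sv; rewrite le_eqVlt; apply/orP; left; apply/eqP.
  by apply: eq_esum => i _; rewrite /s' pickleK.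
Qed.

Lemma cube_coverS A B v w : A `<=` B -> (v <= w)%E ->
  cube_cover B v -> cube_cover A w.
Proof.
move=> AB vw [D [c [s [s0 Bc sv]]]]; exists D, c, s; split => //.
  exact: subset_trans Bc.
exact: le_trans vw.
Qed.

Lemma cube_cover_bigcup (D : set nat) (A : nat -> set 'rV[R]_d)
    (v : nat -> \bar R) : (forall k, D k -> cube_cover (A k) (v k)) ->
  cube_cover (\bigcup_(k in D) A k) (\esum_(k in D) v k).
Proof.
move=> Av.
have /choice[F HF] : forall k,
  exists Dcs : set nat * (nat -> 'rV[R]_d) * (nat -> R),
    D k -> [/\ forall j, 0 <= Dcs.2 j,
      A k `<=` \bigcup_(j in Dcs.1.1) cube (Dcs.1.2 j) (Dcs.2 j) &
      (\esum_(j in Dcs.1.1) ((2 * Dcs.2 j) ^+ d)%:E <= v k)%E].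
  move=> k; have [Dk|nDk] := pselect (D k); last by exists (set0, 0, 0).
  by have [D' [c [s H]]] := Av k Dk; exists (D', c, s).
(* The choice gives no control outside [D], so the half-side is set to 0 there: nonnegativity is
   required at every index. *)
pose s (k : nat * nat) := if `[< D k.1 >] then (F k.1).2 k.2 else 0.
have s_ge0 k : 0 <= s k.
  by rewrite /s; case: asboolP => // Dk; have [] := HF _ Dk.
apply: (@cube_cover_count _ (D `*`` (fun k => (F k).1.1))
  (fun k => (F k.1).1.2 k.2) s) => //.
  move=> x [k Dk Akx]; have [_ + _] := HF k Dk.
  move=> /(_ x Akx)[j Fj xj]; exists (k, j) => //=.
  by rewrite /cube /s /=; case: asboolP.
rewrite -(@esum_esum _ _ _ D (fun k => (F k).1.1)
   (fun k j => ((2 * s (k, j)) ^+ d)%:E)); last first.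
  by move=> k j _ _; rewrite lee_fin exprn_ge0// mulr_ge0.
apply: le_esum => k Dk; have [_ _] := HF k Dk; apply: le_trans.
by rewrite le_eqVlt (eq_esum (b := fun j => ((2 * (F k).2 j) ^+ d)%:E)) ?eqxx//
  => j _; rewrite /s/=; case: asboolP.
Qed.

Lemma null_of_cube_cover A :
  (forall e : R, 0 < e -> cube_cover A e%:E) -> lebesgue_null A.
Proof.
move=> Ac e e0; have [D [c [s [s0 As se]]]] := Ac e e0.
exists D, (fun k => c k - const_mx (s k)), (fun k => c k + const_mx (s k));
  split.
- by move=> k i; rewrite !mxE; have := s0 k; lra.
- move=> x /As[k Dk /= xk]; exists k => // i; rewrite !mxE.
  move/rV_norm_leP : xk => /(_ (s0 k) i); rewrite !mxE ler_norml; lra.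
- apply: le_trans se; apply: le_esum => k _; rewrite lee_fin /box_volume.
  rewrite (eq_bigr (fun=> 2 * s k)) ?prodr_const ?card_ord// => i _.
  by rewrite !mxE; ring.
Qed.


(** The product on the left is a polynomial in [s] whose value at 0 is the product of the [l i];
    continuity at 0 provides [s]. *)
Lemma box_sides (l : 'I_d -> R) (e : R) : (forall i, 0 <= l i) -> 0 < e ->
  exists2 s : R, 0 < s & \prod_(i < d) (l i + s) <= \prod_(i < d) l i + e.
Proof.
move=> l0 e0; pose p : {poly R} := \prod_(i < d) ((l i)%:P + 'X).
have pE s : p.[s] = \prod_(i < d) (l i + s).
  by rewrite horner_prod; apply: eq_bigr => i _; rewrite !hornerE.
have /cvgrPdist_lt /(_ e e0) : horner p x @[x --> 0] --> p.[0].
  exact: continuous_horner.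
rewrite near_simpl => /nbhs_ballP[r /= r0 rp].
exists (r / 2); first by rewrite divr_gt0.
have := rp (r / 2); rewrite -ball_normE /= sub0r normrN gtr0_norm ?divr_gt0//.
have p0 : p.[0] = \prod_(i < d) l i.
  by rewrite pE; apply: eq_bigr => i _; rewrite addr0.
rewrite p0 pE.
have -> : (r / 2 < r) = true by lra.
by move=> /(_ isT); rewrite ltr_norml; lra.
Qed.

(** A grid of mesh [s] is laid over the box. Along axis [i] it needs at most [l i / s + 1] cells, of
    total length at most [l i + s], and [box_sides] bounds the product of these lengths. *)
Lemma box_cube_cover (a b : 'rV[R]_d) (e : R) : (forall i, a 0 i <= b 0 i) ->
  0 < e -> cube_cover (box a b) (box_volume a b + e)%:E.
Proof.
move=> ab e0; pose l i := b 0 i - a 0 i.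
have l0 i : 0 <= l i by rewrite subr_ge0.
have [s s0 sl] := box_sides l0 e0.
pose n i := (Num.truncn (l i / s)).+1.
(* The common bound [N] makes grid cells finite functions into ['I_N]; [family P] keeps those whose
   [i]-th coordinate is below [n i]. *)
pose N := (\max_(i < d) n i)%N.
have nN i : (n i <= N)%N by exact: leq_bigmax.
pose P i := [pred j : 'I_N | (j < n i)%N].
pose r := enum (family P).
apply: (@cube_cover_count {ffun 'I_d -> 'I_N} [set` r]
  (fun f => \row_i (a 0 i + (f i)%:R * s + s / 2)) (fun=> s / 2)).
- by move=> _; rewrite divr_ge0// ltW.
- move=> x xab; pose k i := Num.truncn ((x 0 i - a 0 i) / s).
  have x0 i : 0 <= (x 0 i - a 0 i) / s.
    by rewrite divr_ge0 ?(ltW s0)// subr_ge0; case/andP: (xab i).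
  have kn i : (k i < n i)%N.
    rewrite ltnS; apply: le_truncn; rewrite ler_pM2r ?invr_gt0// lerD2r.
    by case/andP: (xab i).
  have kN i : (k i < N)%N by exact: leq_trans (nN i).
  exists [ffun i => Ordinal (kN i)].
    by rewrite /= mem_enum; apply/familyP => j; rewrite ffunE; exact: kn.
  apply/rV_norm_leP => [|i]; first by rewrite divr_ge0// ltW.
  have /andP[] := truncn_itv (x0 i); rewrite -/(k i).
  rewrite ler_pdivlMr// ltr_pdivrMr// !mxE ffunE /= -natr1 mulrDl mul1r.
  by rewrite ler_norml; lra.
- rewrite esum_fset; last 2 first.
    exact: finite_seq.
    by move=> f _; rewrite lee_fin exprn_ge0// mulr_ge0// divr_ge0// ltW.
  rewrite -fsbig_seq ?enum_uniq// big_enum/= sumEFin lee_fin.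
  apply: le_trans sl.
  rewrite (_ : 2 * (s / 2) = s); last by field.
  (* Written as a product over the axes, the volume of a cell can be summed by distributivity: the
     total is the product over [i] of [n i] times [s]. *)
  have -> : \sum_(f in family P) s ^+ d = \sum_(f in family P) \prod_(i < d) s.
    by apply: eq_bigr => f _; rewrite prodr_const card_ord.
  rewrite -(bigA_distr_big_dep _ (fun _ _ => s)).
  apply: ler_prod => i _; rewrite sumr_ge0/=; last by move=> ? _; exact: ltW.
  rewrite -(big_ord_widen _ (fun=> s) (nN i)) sumr_const card_ord.
  rewrite -mulr_natl -natr1 mulrDl mul1r lerD2r -ler_pdivlMr//.
  by rewrite truncn_le divr_ge0// ltW.
Qed.


Lemma esum_geometric (D : set nat) (e : R) : 0 <= e ->
  (\esum_(k in D) (e / (2 ^ k.+1)%:R)%:E <= e%:E)%E.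
Proof.
move=> e0; have -> : D = [set k | (fun k => `[< D k >]) k].
  by apply/seteqP; split => k /asboolP.
rewrite -nneseries_esum; first exact: epsilon_trick0.
by move=> k _; rewrite lee_fin divr_ge0.
Qed.

(** Half of [e] pays for the boxes; the other half is distributed geometrically over the
    replacements of single boxes by cubes. *)
Lemma null_cube_cover A (e : R) : lebesgue_null A -> 0 < e -> cube_cover A e%:E.
Proof.
move=> /(_ (e / 2)) A0 e0; have e20 : 0 < e / 2 by rewrite divr_gt0.
have [D [a [b [ab Aab abe]]]] := A0 e20.
have ek0 k : 0 < e / 2 / (2 ^ k.+1)%:R.
  by rewrite divr_gt0// ltr0n expn_gt0.
have vol0 k : 0 <= box_volume (a k) (b k).
  by apply: prodr_ge0 => i _; rewrite subr_ge0.
apply: (@cube_coverS _ (\bigcup_(k in D) box (a k) (b k))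
  (\esum_(k in D) (box_volume (a k) (b k) + e / 2 / (2 ^ k.+1)%:R)%:E)) => //.
  under eq_esum do rewrite EFinD.
  rewrite esumD; last 2 first.
  - by move=> k _; rewrite lee_fin.
  - by move=> k _; rewrite lee_fin ltW.
  by rewrite [e in leRHS]splitr EFinD; apply: leeD => //;
    apply/esum_geometric/ltW.
by apply: cube_cover_bigcup => k _; exact: box_cube_cover.
Qed.

Lemma nullS A B : A `<=` B -> lebesgue_null B -> lebesgue_null A.
Proof.
move=> AB B0 e /B0[D [a [b [ab Bab abe]]]]; exists D, a, b; split => //.
exact: subset_trans Bab.
Qed.

Lemma null_bigcup (D : set nat) (A : nat -> set 'rV[R]_d) :
  (forall k, D k -> lebesgue_null (A k)) ->
    lebesgue_null (\bigcup_(k in D) A k).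
Proof.
move=> A0; apply: null_of_cube_cover => e e0.
apply: (@cube_coverS _ (\bigcup_(k in D) A k)
  (\esum_(k in D) (e / (2 ^ k.+1)%:R)%:E)) => //.
  exact/esum_geometric/ltW.
apply: cube_cover_bigcup => k Dk; apply: null_cube_cover; first exact: A0.
by rewrite divr_gt0// ltr0n expn_gt0.
Qed.

Lemma null_bigcup_count (I : countType) (D : set I) (A : I -> set 'rV[R]_d) :
  (forall k, D k -> lebesgue_null (A k)) ->
    lebesgue_null (\bigcup_(k in D) A k).
Proof.
move=> A0; pose A' n := if unpickle n is Some i then A i else set0.
apply: (@nullS _ (\bigcup_(n in pickle @` D) A' n)).
  by move=> x [k Dk Akx]; exists (pickle k); [exists k|rewrite /A' pickleK].
by apply: null_bigcup => _ [k Dk <-]; rewrite /A' pickleK; exact: A0.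
Qed.

(** For each cube of a covering of [B] that contains some [g z] with [z] in [A], one such [z]
    becomes the new centre. Any other point of [A] sent into that cube has image within [2 s] of
    [g z], hence lies within [2 s / c] of [z]. Volumes grow by the factor $(2/c)^d$. *)
Lemma null_expanding A B (g : 'rV[R]_d -> 'rV[R]_d) (c : R) : 0 < c ->
  (forall x y, A x -> A y -> c * `|x - y| <= `|g x - g y|) ->
  (forall x, A x -> B (g x)) -> lebesgue_null B -> lebesgue_null A.
Proof.
move=> c0 gc AB B0; apply: null_of_cube_cover => e e0.
have C0 : 0 < (2 / c) ^+ d by rewrite exprn_gt0// divr_gt0.
have [|D [a [s [s0 Ba se]]]] := @null_cube_cover B (e / (2 / c) ^+ d) B0.
  by rewrite divr_gt0.
have /choice[a' Ha'] : forall k, exists z,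
  (exists2 x, A x & cube (a k) (s k) (g x)) ->
    A z /\ cube (a k) (s k) (g z).
  move=> k; have [[x Ax xk]|no] :=
    pselect (exists2 x, A x & cube (a k) (s k) (g x)).
    by exists x.
  by exists 0.
exists D, a', (fun k => 2 * s k / c); split.
- by move=> k; rewrite divr_ge0 ?(ltW c0)// mulr_ge0.
- move=> x Ax; have [k Dk gxk] := Ba _ (AB _ Ax); exists k => //.
  have [|Az zk] := Ha' k; first by exists x.
  rewrite /cube /= ler_pdivlMr// mulrC (le_trans (gc _ _ Ax Az))//.
  rewrite (_ : g x - g (a' k) = (g x - a k) - (g (a' k) - a k)); last first.
    by rewrite opprB addrA subrK.
  rewrite (le_trans (ler_normB _ _))// mulr_natl mulr2n.
  by rewrite lerD.
- apply: ge_ereal_sup => /= _ [X [finX XD] <-].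
  have -> : \sum_(k \in X) ((2 * (2 * s k / c)) ^+ d)%:E =
     (((2 / c) ^+ d)%:E * \sum_(k \in X) ((2 * s k) ^+ d)%:E)%E.
    rewrite !fsbig_finite//= ge0_sume_distrr.
      apply: eq_bigr => k _; rewrite -EFinM -exprMn; congr (_ ^+ _)%:E.
      by field; rewrite gt_eqF.
    by move=> k _; rewrite lee_fin exprn_ge0// mulr_ge0.
  rewrite -lee_pdivlMl// muleC -EFinM.
  by apply: le_trans se; apply: ereal_sup_ubound; exists X.
Qed.

(** The hyperplane is a countable union of bounded pieces, each inside a box with one side of length
    0. *)
Lemma null_hyperplane (i : 'I_d) : lebesgue_null [set x : 'rV[R]_d | x 0 i = 0].
Proof.
apply: (@nullS _ (\bigcup_n [set x : 'rV[R]_d | x 0 i = 0 /\ `|x| <= n%:R])).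
  move=> x xi; exists (Num.truncn `|x|).+1 => //; split => //.
  exact/ltW/truncnS_gt.
apply: null_bigcup => n _ e e0.
exists [set 0%N], (fun=> \row_j (if j == i then 0 else - n%:R)),
  (fun=> \row_j (if j == i then 0 else n%:R)); split.
- by move=> _ j; rewrite !mxE; case: ifP => // _;
  rewrite -subr_ge0 opprK addr_ge0.
- move=> x [xi xn]; exists 0%N => // j; rewrite !mxE.
  case: eqP => [->|_]; first by rewrite xi lexx.
  by rewrite -ler_norml (le_trans _ xn)// rV_norm_coord.
- have vol0 : box_volume (\row_j (if j == i then 0 else - n%:R) : 'rV[R]_d)
      (\row_j (if j == i then 0 else n%:R)) = 0.
    by rewrite /box_volume (bigD1 i)//= !mxE eqxx subrr mul0r.
  by rewrite vol0 esum_set1// lee_fin ltW.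
Qed.

End NullSets.

(** * The proximal map *)

Lemma rV_nearP (R : realType) n (x : 'rV[R]_n) (P : 'rV[R]_n -> Prop) :
  (\forall y \near x, P y) <-> exists2 r : R, 0 < r & forall y, `|y - x| < r ->
    P y.
Proof.
split=> [/nbhs_ballP[r r0 rP]|[r r0 rP]].
  by exists r => // y yr; apply: rP; rewrite -ball_normE /= distrC.
by apply/nbhs_ballP; exists r => // y; rewrite -ball_normE /= distrC; exact: rP.
Qed.

(** * Inner product and comparison with the sup norm *)

Section DotTheory.
Context {R : realType} {n : nat}.
Implicit Types u v w : 'rV[R]_n.

Lemma dotE u v : dot u v = (u *m v^T) 0 0.
Proof. by rewrite mxE; apply: eq_bigr => i _; rewrite mxE. Qed.

Lemma dotC u v : dot u v = dot v u.
Proof. by apply: eq_bigr => i _; rewrite mulrC. Qed.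

Lemma dotDl u v w : dot (u + v) w = dot u w + dot v w.
Proof. by rewrite !dotE mulmxDl mxE. Qed.

Lemma dotDr u v w : dot w (u + v) = dot w u + dot w v.
Proof. by rewrite dotC dotDl !(dotC w). Qed.

Lemma dotZl a u w : dot (a *: u) w = a * dot u w.
Proof. by rewrite !dotE -scalemxAl mxE. Qed.

Lemma dotZr a u w : dot w (a *: u) = a * dot w u.
Proof. by rewrite dotC dotZl (dotC w). Qed.

Lemma dotNl u w : dot (- u) w = - dot u w.
Proof. by rewrite -scaleN1r dotZl mulN1r. Qed.

Lemma dotNr u w : dot w (- u) = - dot w u.
Proof. by rewrite dotC dotNl (dotC w). Qed.

Lemma dotBl u v w : dot (u - v) w = dot u w - dot v w.
Proof. by rewrite dotDl dotNl. Qed.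

Lemma dotBr u v w : dot w (u - v) = dot w u - dot w v.
Proof. by rewrite dotDr dotNr. Qed.

Lemma dot0l u : dot 0 u = 0.
Proof. by rewrite -(scale0r u) dotZl mul0r. Qed.

Lemma dot0r u : dot u 0 = 0.
Proof. by rewrite dotC dot0l. Qed.

Lemma dot_ge0 u : 0 <= dot u u.
Proof. by apply: sumr_ge0 => i _; rewrite -expr2 sqr_ge0. Qed.

Lemma enorm_sqr u : enorm u ^+ 2 = dot u u.
Proof. by rewrite sqr_sqrtr// dot_ge0. Qed.

Lemma enorm_ge0 u : 0 <= enorm u.
Proof. exact: sqrtr_ge0. Qed.

Lemma norm_sqr_le_dot u : `|u| ^+ 2 <= dot u u.
Proof.
rewrite -(sqr_sqrtr (dot_ge0 u)) ler_sqr ?nnegrE ?sqrtr_ge0//.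
apply/rV_norm_leP => [|i]; first exact: sqrtr_ge0.
rewrite -sqrtr_sqr ler_wsqrtr// /dot (bigD1 i)//= expr2 lerDl.
by apply: sumr_ge0 => j _; rewrite -expr2 sqr_ge0.
Qed.

(** The factor [n.+1] instead of [n] keeps the constant positive in dimension 0, so that one may
    divide by it. *)
Lemma dot_norm_le u v : `|dot u v| <= n.+1%:R * `|u| * `|v|.
Proof.
apply: le_trans (_ : n%:R * (`|u| * `|v|) <= _); last first.
  by rewrite -mulrA ler_wpM2r ?mulr_ge0// ler_nat.
apply: (le_trans (ler_norm_sum _ _ _)).
rewrite -[n in n%:R]card_ord -sum1_card natr_sum mulr_suml; apply: ler_sum =>
  i _.
by rewrite mul1r normrM ler_pM ?rV_norm_coord.
Qed.

Lemma dot_le_norm_sqr u : dot u u <= n.+1%:R * `|u| ^+ 2.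
Proof. by rewrite expr2 mulrA (le_trans (ler_norm _))// dot_norm_le. Qed.

Lemma dot_eq0 u : dot u u = 0 -> u = 0.
Proof.
move=> u0; apply/eqP; rewrite -normr_eq0 -sqrf_eq0 eq_le sqr_ge0 andbT.
by rewrite -u0 norm_sqr_le_dot.
Qed.

Lemma dot_convex u v (t : R) :
  dot (t *: u + (1 - t) *: v) (t *: u + (1 - t) *: v) =
  t * dot u u + (1 - t) * dot v v - t * (1 - t) * dot (u - v) (u - v).
Proof.
rewrite !(dotDl, dotDr, dotNl, dotNr, dotZl, dotZr) (dotC v u); ring.
Qed.

Lemma dot_continuous u : continuous (fun v => dot (v - u) (v - u)).
Proof.
move=> v; apply: (cvg_big add_continuous _ (F := nbhs v)) => i _; apply: cvgM;
  rewrite !mxE.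
all: under eq_fun do rewrite !mxE.
all: by apply: cvgB; [exact: coord_continuous|exact: cvg_cst].
Qed.

Lemma dot_suml m (u : 'I_m -> 'rV[R]_n) v :
  dot (\sum_j u j) v = \sum_j dot (u j) v.
Proof.
by rewrite dotE mulmx_suml summxE; apply: eq_bigr => j _; rewrite dotE.
Qed.

Lemma dot_delta u i : dot u (delta_mx 0 i) = u 0 i.
Proof. by rewrite dotE trmx_delta -colE mxE. Qed.

End DotTheory.

Lemma dot_mulmxr {R : realType} n m (u : 'rV[R]_m) (v : 'rV[R]_n)
  (M : 'M[R]_(n, m)) :
  dot u (v *m M) = dot (u *m M^T) v.
Proof. by rewrite !dotE trmx_mul mulmxA. Qed.

Lemma closed_ball_compact (R : realType) d (p : 'rV[R]_d) (s : R) :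
  compact [set y : 'rV[R]_d | `|y - p| <= s].
Proof.
apply: bounded_closed_compact.
  exists (s + `|p|); split; first exact: num_real.
  move=> M sM y /= ys; rewrite -(subrK p y) (le_trans (ler_normD _ _))//.
  by rewrite (le_trans _ (ltW sM))// lerD2r.
have -> : [set y : 'rV[R]_d | `|y - p| <= s] = closed_ball_ Num.norm p s.
  by apply/seteqP; split => y; rewrite /closed_ball_ /= distrC.
exact: closed_closed_ball_.
Qed.

(** The sublevel sets in [K] for levels above the infimum generate a proper filter. Being closed,
    they all contain its cluster point, which is therefore a minimizer. If the infimum is [+oo], any
    point of [K] will do. *)
Lemma compact_lsc_min (R : realType) (T : topologicalType) (K : set T)
  (h : T -> \bar R) :
  K !=set0 -> compact K -> (forall r : R, closed [set x | (h x <= r%:E)%E]) ->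
  exists2 p, K p & forall z, K z -> (h p <= h z)%E.
Proof.
move=> [k0 Kk0] cK clh; pose m := ereal_inf (h @` K).
have mh z : K z -> (m <= h z)%E by move=> Kz; apply: ereal_inf_lbound; exists z.
have [moo|moo] := eqVneq m +oo%E; last first.
  have [r0 mr0] : exists r0 : R, (m < r0%:E)%E.
    move: moo; case: m {mh} => [r| |] // _; last by exists 0; rewrite ltNyr.
    by exists (r + 1); rewrite lte_fin ltrDl.
  pose F := filter_from [set r : R | (m < r%:E)%E]
    (fun r => K `&` [set x | (h x <= r%:E)%E]).
  have FF : ProperFilter F.
    apply: filter_from_proper; last first.
      move=> r /= mr; have /ereal_inf_lt[_ [x Kx <-] xr]
        : (ereal_inf (h @` K) < r%:E)%E := mr.
      by exists x; split => //; exact: ltW.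
    apply: filter_from_filter; first by exists r0.
    move=> r s /= mr ms; exists (Num.min r s); first by rewrite EFin_min lt_min
      mr.
    move=> x [Kx]; rewrite /= EFin_min le_min => /andP[xr xs].
    by split; split.
  have [|p [Kp cp]] := cK F FF; first by exists r0 => // x [].
  exists p => // z Kz; apply: le_trans (mh z Kz).
  have hp r : (m < r%:E)%E -> (h p <= r%:E)%E.
    move=> mr; have clr : closed [set x | (h x <= r%:E)%E] by exact: clh.
    apply: (clr p) => B pB; have [|x [[_ xr] Bx]] :=
      cp (K `&` [set x | (h x <= r%:E)%E]) B _ pB.
      by exists r.
    by exists x; split.
  case: m moo {mh mr0 F FF cp} hp => [s _ hp| |_ hp] //.
    by apply/lee_addgt0Pr => e e0; apply: hp; rewrite lte_fin ltrDl.
  by rewrite (@eq_ninfty _ (h p)) => [|r]//; apply: hp; rewrite ltNyr.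
exists k0 => // z Kz; rewrite (le_trans (leey _))// -moo; exact: mh.
Qed.

Section Prox.
Context {R : realType} {d : nat} (f : 'rV[R]_d -> \bar R) (rho mu : R).
Hypothesis f_gtNy : forall x, f x != -oo%E.
Hypothesis f_proper : exists x, f x != +oo%E.
Hypothesis f_closed : closed_epigraph f.
Hypothesis f_wconvex : weakly_convex rho f.
Hypothesis mu_gt0 : 0 < mu.
Hypothesis rho_lt : rho < mu^-1.
(** This is the modulus of strong convexity of the proximal objective. *)
Let c := mu^-1 - rho.
Let c_gt0 : 0 < c. Proof. by rewrite subr_gt0. Qed.

(** Weak convexity loses [rho / 2] and the proximal term gains [mu^-1 / 2] times the same multiple
    of $|y-z|^2$, both by the identity [dot_convex]. *)
Lemma prox_objective_convex x y z (a b t : R) : f y = a%:E -> f z = b%:E ->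
  0 < t < 1 ->
  (prox_objective mu f x (t *: y + (1 - t) *: z) <=
   (t * (a + (2 * mu)^-1 * dot (y - x) (y - x)) +
    (1 - t) * (b + (2 * mu)^-1 * dot (z - x) (z - x)) -
    c / 2 * (t * (1 - t)) * dot (y - z) (y - z))%:E)%E.
Proof.
move=> fy fz t01; have /= := f_wconvex y z t01.
rewrite fy fz /prox_objective !enorm_sqr -!EFinD.
have -> : t *: y + (1 - t) *: z - x = t *: (y - x) + (1 - t) *: (z - x).
  by rewrite !scalerBr !scalerBl !scale1r; apply/rowP => i; rewrite !mxE; ring.
have -> : dot (y - z) (y - z) = dot ((y - x) - (z - x)) ((y - x) - (z - x)).
  by rewrite opprB addrA subrK.
rewrite dot_convex (dot_convex (y - x)).
have -> : dot (y - x - (z - x)) (y - x - (z - x)) = dot (y - z) (y - z).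
  by rewrite opprB addrA subrK.
case: (f _) => [e| |]; [|by rewrite !addye// leye_eq|by move=> _;
  rewrite addNye leNye].
rewrite -!EFinD !lee_fin; set Y := dot y y; set Z := dot z z.
set W := dot (y - z) _; set P := dot (y - x) _; set Q := dot (z - x) _ => h.
rewrite (_ : (2 * mu)^-1 = mu^-1 / 2); last by rewrite invfM mulrC.
rewrite /c; move: h; lra.
Qed.

Lemma closed_prox_objective x (r : R) :
  closed [set y | (prox_objective mu f x y <= r%:E)%E].
Proof.
pose g (y : 'rV[R]_d) : 'rV[R]_d * R :=
  (y, r - (2 * mu)^-1 * dot (y - x) (y - x)).
have q_cont (y : 'rV[R]_d) : r - (2 * mu)^-1 * dot (y' - x) (y' - x) @[y' --> y]
  -->
    r - (2 * mu)^-1 * dot (y - x) (y - x).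
  have FF : Filter (nbhs y) := nbhs_filter y.
  apply: (cvgB (F := nbhs y)); first exact: (@cvg_cst _ r _ (nbhs y)).
  by apply: (cvgMl_tmp (F := nbhs y)); exact: dot_continuous.
have -> : [set y | (prox_objective mu f x y <= r%:E)%E] =
    g @^-1` [set z | (f z.1 <= z.2%:E)%E].
  by apply/seteqP; split => y; rewrite /=
    /prox_objective enorm_sqr EFinB leeBrDr.
apply: closed_comp => // y _.
exact: (cvg_pair (@cvg_id _ (nbhs (y : 'rV[R]_d))) (q_cont y)).
Qed.


Lemma prox_set_fin x p : prox_set mu f x p -> f p \is a fin_num.
Proof.
move=> px; have [x0 fx0] := f_proper; have := px x0.
move: (f_gtNy p) (f_gtNy x0) fx0; rewrite /prox_objective.
by case: (f p) => [a| |]//; case: (f x0) => [b| |]//.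
Qed.

(** Let [m] be the minimum over the unit ball around a point [x0] of finite value [A]. By strong
    convexity along the segment from [x0] to a distant [z], a value below [A] at [z] would push the
    value at distance 1 from [x0] below [m]. So a minimizer over a large ball is global. *)
Lemma prox_exists x : prox_set mu f x !=set0.
Proof.
have [x0 fx0] := f_proper.
have {fx0} [a fx0] : exists a, f x0 = a%:E.
  by move: fx0 (f_gtNy x0); case: (f x0) => // a _ _; exists a.
have ball0 (r : R) : 0 <= r -> [set y : 'rV[R]_d | `|y - x0| <= r] !=set0.
  by move=> r0; exists x0; rewrite /= subrr normr0.
have [p1 /= Kp1 p1min] := compact_lsc_min (ball0 1 ler01)
  (@closed_ball_compact _ _ x0 1)
  (@closed_prox_objective x).
pose A := a + (2 * mu)^-1 * dot (x0 - x) (x0 - x).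
have A0 : prox_objective mu f x x0 =
  A%:E by rewrite /prox_objective fx0 enorm_sqr.
have [m mE mA] : exists2 m : R, prox_objective mu f x p1 = m%:E & m <= A.
  have := p1min x0; rewrite /= subrr normr0 ler01 => /(_ isT).
  rewrite A0; move: (f_gtNy p1); rewrite /prox_objective.
  by case: (f p1) => [b| |]// _; rewrite -EFinD lee_fin => ?; eexists.
(* A distance [l] above [r] satisfies [2 * (A - m) <= c * (l - 1)], which is what the comparison on
   the segment requires. *)
pose r := 1 + (1 + 2 * (A - m) / c).
have r1 : 1 <= r.
  by rewrite lerDl addr_ge0// divr_ge0 ?(ltW c_gt0)// mulr_ge0// subr_ge0.
have far z : r < `|z - x0| -> (A%:E <= prox_objective mu f x z)%E.
  move=> rz; pose l := `|z - x0|; have l1 : 1 < l by exact: le_lt_trans rz.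
  have l0 : 0 < l by exact: lt_trans l1.
  case E : (f z) (f_gtNy z) => [b| |]// _; last first.
    by rewrite /prox_objective E addye// leey.
  (* With weight [l^-1] on [z] the convex combination is at distance exactly 1 from [x0]. *)
  have t01 : 0 < l^-1 < 1 by rewrite invr_gt0 l0 invf_lt1.
  have := prox_objective_convex x E fx0 t01.
  have := p1min (l^-1 *: z + (1 - l^-1) *: x0); rewrite /=.
  have -> : l^-1 *: z + (1 - l^-1) *: x0 - x0 = l^-1 *: (z - x0).
    by rewrite scalerBl scale1r scalerBr addrAC -!addrA addKr addrC.
  rewrite normrZ gtr0_norm ?invr_gt0// mulVf ?gt_eqF// => /(_ (lexx _)).
  rewrite mE => /le_trans /[apply].
  rewrite lee_fin -/A /prox_objective E enorm_sqr -EFinD lee_fin.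
  set B := b + _ => h.
  have dl := norm_sqr_le_dot (z - x0); rewrite -/l in dl.
  set D := dot (z - x0) _ in h dl.
  have {dl} h2 : m <= l^-1 * B + (1 - l^-1) * A - c /
    2 * (l^-1 * (1 - l^-1)) * l ^+ 2.
    apply: le_trans h _; rewrite lerD2l lerN2 ler_wpM2l//.
    by rewrite mulr_ge0// ?divr_ge0 ?(ltW c_gt0)// mulr_ge0 ?subr_ge0;
      case/andP: t01 => /ltW + /ltW.
  have {h2} h3 : m * l <= B + (l - 1) * A - c / 2 * (l - 1) * l.
    have := ler_wpM2r (ltW l0) h2; congr (_ <= _); field; by rewrite gt_eqF.
  have h4 : 2 * (A - m) <= c * (l - 1).
    rewrite -ler_pdivrMl// mulrC; move: rz; rewrite -/l /r; lra.
  have h5 : 2 * (A - m) * l <= c * (l - 1) * l by rewrite ler_wpM2r// ltW.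
  lra.
have [p /= Kp pmin] := compact_lsc_min (ball0 r (le_trans ler01 r1))
  (@closed_ball_compact _ _ x0 r) (@closed_prox_objective x).
exists p => z; have [zr|zr] := leP (`|z - x0|) r; first exact: pmin.
apply: le_trans (far z zr); rewrite -A0; apply: pmin.
by rewrite subrr normr0; exact: le_trans r1.
Qed.

Lemma proxP x : prox_set mu f x (prox mu f x).
Proof. by apply: xgetPex; exact: prox_exists. Qed.

(* Strong convexity at the midpoint alone costs a factor 2: the optimal constant
   is c / 2. *)
Lemma prox_growth x z (a b : R) : f (prox mu f x) = a%:E -> f z = b%:E ->
  a + (2 * mu)^-1 * dot (prox mu f x - x) (prox mu f x - x) +
    c / 4 * dot (prox mu f x - z) (prox mu f x - z) <=
  b + (2 * mu)^-1 * dot (z - x) (z - x).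
Proof.
have t01 : 0 < (2^-1 : R) < 1 by rewrite invr_gt0 ltr0n/= invf_lt1 ?ltr0n//
  ltr1n.
move=> fp fz.
have := le_trans (proxP x _) (prox_objective_convex x fp fz t01).
rewrite /prox_objective fp enorm_sqr -EFinD lee_fin; lra.
Qed.

(** Each proximal point is compared with the other one as a competitor. In the sum of the two growth
    inequalities the values of [f] cancel and the squared distances combine to $2\langle
    p-q,x-y\rangle$. *)
Lemma prox_monotone x y :
  mu * c / 2 * dot (prox mu f x - prox mu f y) (prox mu f x - prox mu f y) <=
  dot (prox mu f x - prox mu f y) (x - y).
Proof.
have /fineK/esym := prox_set_fin (proxP x); set p := prox mu f x; set a :=
  fine _ => fp.
have /fineK/esym := prox_set_fin (proxP y); set q := prox mu f y; set b :=
  fine _ => fq.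
have := prox_growth fp fq; have := prox_growth fq fp; rewrite -/p -/q.
have -> : dot (q - p) (q - p) = dot (p - q) (p - q).
  by rewrite -(opprB p q) dotNl dotNr opprK.
move=> h1 h2.
have {h1 h2} : c / 2 * dot (p - q) (p - q) <= (2 * mu)^-1 *
    (dot (q - x) (q - x) + dot (p - y) (p - y) - dot (p - x) (p - x) - dot
      (q - y) (q - y)).
  lra.
have -> : dot (q - x) (q - x) + dot (p - y) (p - y) - dot (p - x) (p - x) -
    dot (q - y) (q - y) = 2 * dot (p - q) (x - y).
  rewrite !(dotBl, dotBr) (dotC x p) (dotC x q) (dotC y p) (dotC y q); ring.
rewrite ler_pdivlMl ?mulr_gt0//; lra.
Qed.

(** Expanding the square in the minimality of $p$ gives $f(z)\ge f(p)+\mu^{-1}\langle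
    x-p,z-p\rangle-\frac1{2\mu}\|z-p\|^2$, and the last term is $o(\|z-p\|)$. *)
Lemma prox_subdifferential x :
  subdifferential f (prox mu f x) (mu^-1 *: (x - prox mu f x)).
Proof.
set p := prox mu f x; split; first exact: prox_set_fin (proxP x).
have /fineK/esym := prox_set_fin (proxP x); rewrite -/p; set a := fine _ => fp.
move=> e e0; apply/rV_nearP; exists (d.+1%:R^-1 * (2 * mu * e)) => [|z zr].
  by rewrite mulr_gt0 ?invr_gt0 ?ltr0n ?mulr_gt0.
case E : (f z) (f_gtNy z) => [b| |]// _; last by rewrite leey.
rewrite fp -EFinD lee_fin.
have := proxP x z; rewrite -/p /prox_objective fp E !enorm_sqr -!EFinD lee_fin.
have -> : z - x = (z - p) + (p - x) by rewrite addrA subrK.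
rewrite (dotDl (z - p) (p - x)) !(dotDr (z - p) (p - x)) -(enorm_sqr (z - p))
  (dotC (p - x) (z - p)).
rewrite dotZl -(opprB p x) dotNl (dotC (p - x)).
set N := enorm (z - p); set P := dot (p - x) _; set Q := dot _ _ => h.
suff : (2 * mu)^-1 * N ^+ 2 <= e * N.
  by move: h; rewrite invfM; lra.
rewrite expr2 mulrA ler_wpM2r ?enorm_ge0//.
rewrite ler_pdivrMl ?mulr_gt0//.
rewrite -ler_sqr ?nnegrE ?enorm_ge0//; last by rewrite !mulr_ge0// ltW.
rewrite enorm_sqr (le_trans (dot_le_norm_sqr _))//.
have d1 : 1 <= d.+1%:R :> R by rewrite ler1n.
apply: (@le_trans _ _ ((d.+1%:R * `|z - p|) ^+ 2)).
  by rewrite exprMn ler_wpM2r ?sqr_ge0// expr2 ler_peMr// (le_trans ler01).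
rewrite ler_sqr ?nnegrE//; last by rewrite !mulr_ge0// ltW.
by rewrite -ler_pdivlMl ?ltr0n// ltW.
Qed.

End Prox.

(** * Strictly differentiable gradients *)

Lemma mx_norm_entry (R : realType) m n (M : 'M[R]_(m, n)) i j : `|M i j| <=
  `|M|.
Proof.
rewrite [leRHS]/Num.norm /= mx_normrE; apply/bigmax_geP; right => /=.
by exists (i, j).
Qed.

Lemma mulmx_norm_le (R : realType) m n (u : 'rV[R]_m) (M : 'M[R]_(m, n)) :
  `|u *m M| <= m.+1%:R * `|M| * `|u|.
Proof.
apply/rV_norm_leP => [|j]; first by rewrite !mulr_ge0.
apply: le_trans (_ : m%:R * (`|M| * `|u|) <= _); last first.
  by rewrite -mulrA ler_wpM2r ?mulr_ge0// ler_nat.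
rewrite mxE (le_trans (ler_norm_sum _ _ _))//.
rewrite -[m in m%:R]card_ord -sum1_card natr_sum mulr_suml; apply: ler_sum =>
  i _.
by rewrite mul1r normrM mulrC ler_pM ?rV_norm_coord ?mx_norm_entry.
Qed.

Lemma norm_scaled_sum_le (R : realType) n m (l : 'rV[R]_m)
  (u : 'I_m -> 'rV[R]_n) (e : R) :
  0 <= e -> (forall j, `|u j| <= e) ->
  `|\sum_j l 0 j *: u j| <= m%:R * e * `|l|.
Proof.
move=> e0 ue; rewrite (le_trans (ler_norm_sum _ _ _))//.
rewrite -mulrA (_ : m%:R * _ = \sum_(j < m) (e * `|l|)); last first.
  by rewrite sumr_const card_ord mulr_natl.
by apply: ler_sum => j _; rewrite normrZ mulrC ler_pM ?rV_norm_coord.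
Qed.

Lemma is_derive_quadratic (R : realType) (V : normedModType R) (f : V -> R^o)
    (y v : V) (a b : R) :
  (forall t : R, f (t *: v + y) = f y + t * a + t ^+ 2 * b) ->
  is_derive y v f a.
Proof.
move=> fE; have cv : (fun h : R =>
  h^-1 *: ((f \o shift y) (h *: v) - f y : R^o)) @ 0^' --> (a : R^o).
  apply: (@cvg_trans _ ((fun h : R => a + h * b) @ 0^')).
    apply: near_eq_cvg; near=> h; have h0 : h != 0 by near: h;
      exact: nbhs_dnbhs_neq.
    by rewrite /= fE /GRing.scale/=; field.
  have -> : nbhs (a : R^o) = nbhs (a + 0 * b) by rewrite mul0r addr0.
  apply: cvg_within_filter; apply: cvgD; first exact: cvg_cst.
  by apply: cvgMr_tmp; exact: cvg_id.
by split; [apply/cvg_ex; exists a|exact: cvg_lim].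
Unshelve. all: by end_near. Qed.

Lemma independent_right_inverse (R : realType) n m (u : 'I_m -> 'rV[R]_n) :
  (forall l : 'rV[R]_m, \sum_j l 0 j *: u j = 0 -> l = 0) ->
  exists B : 'M[R]_(n, m), forall l : 'rV[R]_m, (\sum_j l 0 j *: u j) *m B = l.
Proof.
move=> inj; pose N : 'M[R]_(m, n) := \matrix_j u j.
have NE (l : 'rV[R]_m) : l *m N = \sum_j l 0 j *: u j.
  by rewrite mulmx_sum_row; apply: eq_bigr => j _; rewrite rowK.
have /row_freeP[B NB] : row_free N.
  rewrite -kermx_eq0; apply/eqP/row_matrixP => i; rewrite row0.
  by apply: inj; rewrite -NE -row_mul mulmx_ker row0.
by exists B => l; rewrite -NE -mulmxA NB mulmx1.
Qed.

Section Calculus.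
Context {R : realType} {d : nat}.
Implicit Types (x y p q v h : 'rV[R]_d) (phi psi : 'rV[R]_d -> R)
  (g k : 'rV[R]_d -> 'rV[R]_d).

(** Both points move, so that differences of two orbits, or of two optimality conditions, are
    compared with one linear map. Vectors are rows, hence the derivative acts from the right. *)
Definition strictly_diff n (g : 'rV[R]_d -> 'rV[R]_n) x (M : 'M[R]_(d, n)) :=
  forall e : R, 0 < e -> exists2 r : R, 0 < r &
    forall p q, `|p - x| < r -> `|q - x| < r ->
      `|g p - g q - (p - q) *m M| <= e * `|p - q|.

(* Directional derivatives suffice: the gradient fields in use are Lipschitz. *)
Definition has_grad phi g x (r : R) :=
  forall y, `|y - x| < r -> forall v,
    is_derive y v (phi : _ -> R^o) (dot (g y) v).

(** A pointwise substitute for $C^2$ smoothness: a gradient exists near [x] and is strictly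
    differentiable at [x], with Hessian [H]. *)
Definition C2_at phi g x (H : 'M[R]_d) :=
  (exists2 r : R, 0 < r & has_grad phi g x r) /\ strictly_diff g x H.

Lemma is_derive_line (phi : 'rV[R]_d -> R^o) q v (s : R) a :
  is_derive (q + s *: v) v phi a ->
  is_derive (s : R^o) (1 : R^o) (fun t : R^o => phi (q + (t : R) *: v)) a.
Proof.
move=> [phid phiE].
have E : (fun h : R => h^-1 *:
  (((fun t : R^o => phi (q + (t : R) *: v)) \o shift (s : R^o)) (h *: (1 : R^o))
  -
     phi (q + s *: v))) =
  (fun h : R => h^-1 *: ((phi \o shift (q + s *: v)) (h *: v) - phi
    (q + s *: v))).
  apply/funext => h /=; congr (_ *: (phi _ - _)).
  by rewrite scalerDl addrCA [h *: _]mulr1.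
by split; rewrite /derivable /derive E.
Qed.

Lemma segment_ball x p q (r s : R) : 0 <= s <= 1 -> `|p - x| < r ->
  `|q - x| < r ->
  `|q + s *: (p - q) - x| < r.
Proof.
move=> /andP[s0 s1] px qx.
have -> : q + s *: (p - q) - x = s *: (p - x) + (1 - s) *: (q - x).
  by apply/rowP => i; rewrite !mxE; ring.
rewrite (le_lt_trans (ler_normD _ _))//
  !normrZ (ger0_norm s0) ger0_norm ?subr_ge0//.
have [->|sn0] := eqVneq s 0; first by rewrite mul0r add0r subr0 mul1r.
have sp : 0 < s by rewrite lt_neqAle eq_sym sn0.
rewrite (@lt_le_trans _ _ (s * r + (1 - s) * r))//; last by rewrite le_eqVlt;
  apply/orP; left; apply/eqP; ring.
rewrite ltr_leD ?ltr_pM2l// ler_wpM2l ?subr_ge0//; exact: ltW.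
Qed.

Lemma grad_MVT phi g x (r : R) p q : has_grad phi g x r ->
  `|p - x| < r -> `|q - x| < r ->
  exists2 s : R, 0 <= s <= 1 & phi p - phi q =
    dot (g (q + s *: (p - q))) (p - q).
Proof.
move=> hg px qx; pose f (t : R^o) := (phi : _ -> R^o) (q + (t : R) *: (p - q)).
have fd (t : R) : 0 <= t <= 1 ->
  is_derive (t : R^o) (1 : R^o) f (dot (g (q + t *: (p - q))) (p - q)).
  by move=> t01; apply: is_derive_line; apply: hg; exact: segment_ball.
have [] := @MVT_segment R f (fun t => dot (g (q + t *: (p - q))) (p - q)) 0 1
  ler01.
- by move=> t; rewrite in_itv/= => /andP[/ltW t0 /ltW t1]; apply: fd;
  rewrite t0.
- apply: derivable_within_continuous => t; rewrite in_itv/= => t01.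
  by have [] := fd t t01.
- move=> s; rewrite in_itv/= => s01;
  rewrite /f scale0r addr0 scale1r subr0 mulr1 (addrC q) subrK.
  by move=> E; exists s.
Qed.

Lemma grad_strict phi g x (r e : R) : 0 <= e -> has_grad phi g x r ->
  (forall z, `|z - x| < r -> `|g z - g x| <= e) ->
  forall p q, `|p - x| < r -> `|q - x| < r ->
    `|phi p - phi q - dot (g x) (p - q)| <= d.+1%:R * e * `|p - q|.
Proof.
move=> e0 hg ge p q px qx; have [s s01 ->] := grad_MVT hg px qx.
rewrite -dotBl (le_trans (dot_norm_le _ _))// ler_wpM2r// ler_wpM2l//.
by apply: ge; exact: segment_ball.
Qed.

Lemma strictly_diff_lip n (g : 'rV[R]_d -> 'rV[R]_n) x M : strictly_diff g x M
  ->
  exists r C : R, [/\ 0 < r, 0 < C & forall p q, `|p - x| < r -> `|q - x| < r ->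
    `|g p - g q| <= C * `|p - q|].
Proof.
move=> /(_ 1 ltr01)[r r0 gr]; exists r, (1 + d.+1%:R * `|M|); split=> //.
move=> p q px qx; rewrite -(subrK ((p - q) *m M) (g p - g q)).
rewrite (le_trans (ler_normD _ _))// mulrDl lerD ?mulmx_norm_le//.
exact: gr.
Qed.

Lemma C2_at_strict phi g x H : C2_at phi g x H -> forall e : R, 0 < e ->
  exists2 r : R, 0 < r & forall p q, `|p - x| < r -> `|q - x| < r ->
    `|phi p - phi q - dot (g x) (p - q)| <= e * `|p - q|.
Proof.
move=> [[r1 r10 hg] /strictly_diff_lip[r2 [C [r20 C0 gC]]]] e e0.
pose r3 := e / d.+1%:R / C.
have r30 : 0 < r3 by rewrite !divr_gt0.
exists (Num.min r1 (Num.min r2 r3)); first by rewrite !lt_min r10 r20.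
move=> p q px qx; have -> : e = d.+1%:R * (C * r3).
  by rewrite /r3; field; rewrite nat1r pnatr_eq0 gt_eqF.
apply: grad_strict px qx.
- by rewrite mulr_ge0 ?ltW.
- by move=> y; rewrite !lt_min => /andP[yr _]; exact: hg.
- move=> z; rewrite !lt_min => /and3P[_ zr2 zr3].
  by rewrite (le_trans (gC _ _ _ _)) ?subrr ?normr0// ler_pM2l// ltW.
Qed.


(** The second difference $\varphi(x+ta+tb)-\varphi(x+ta)-\varphi(x+tb)+\varphi(x)$ equals
    $t^2\langle bH,a\rangle+o(t^2)$ and is symmetric in $a$ and $b$. *)
Lemma C2_at_sym phi g x H : C2_at phi g x H -> H^T = H.
Proof.
move=> [[r r0 hg] gH].
suff sym u v : dot (v *m H) u = dot (u *m H) v.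
  apply/matrixP => i j; have := sym (delta_mx 0 i) (delta_mx 0 j).
  by rewrite !dot_delta -!rowE !mxE => ->.
have key (a b : 'rV[R]_d) (e : R) : 0 < e -> \forall t \near 0^'+,
    `|(phi (x + t *: a + t *: b) - phi (x + t *: a) - phi (x + t *: b) + phi x)
      - t ^+ 2 * dot (b *m H) a| <= e * t ^+ 2.
  move=> e0; pose K := d.+1%:R * (`|a| + 1) * (`|b| + 1).
  have K0 : 0 < K by rewrite !mulr_gt0// ltr_wpDl.
  have [r1 r10 gr] := gH (e / K) (divr_gt0 e0 K0).
  pose s := `|a| + `|b| + 1; have s0 : 0 < s by rewrite ltr_wpDl// addr_ge0.
  near=> t; have t0 : 0 < t by near: t; exact: nbhs_right_gt.
  have tr : t * s < Num.min r r1.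
    rewrite -ltr_pdivlMr//; near: t; apply: nbhs_right_lt.
    by rewrite divr_gt0// lt_min r0.
  have [tar tbr] : t * `|a| + t * `|b| < r /\ t * `|a| + t * `|b| < r1.
    apply/andP; rewrite -lt_min (le_lt_trans _ tr)// -mulrDr ler_pM2l// /s.
    by rewrite lerDl.
  have ball1 (c : R) : 0 <= c <= 1 -> `|x + c *: (t *: a) - x| <= t * `|a|.
    move=> /andP[c0 c1]; rewrite addrAC subrr add0r !normrZ (ger0_norm c0)
      gtr0_norm//.
    by rewrite ler_piMl// mulr_ge0// ltW.
  have ball2 (c : R) : 0 <= c <= 1 -> `|x + t *: b + c *: (t *: a) - x| <=
    t * `|a| + t * `|b|.
    move=> c01; have -> : x + t *: b + c *: (t *: a) - x =
      (x + c *: (t *: a) - x) + t *: b.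
      by apply/rowP => i; rewrite !mxE; ring.
    by rewrite (le_trans (ler_normD _ _))// lerD ?ball1// normrZ gtr0_norm.
  (* The second difference is the increment over $[0,1]$ of the difference of [phi] along two
     parallel segments of direction [a]. The mean value theorem turns it into a difference of
     gradients at points exactly [t *: b] apart. *)
  pose f (w : R) := phi (x + t *: b + w *: (t *: a)) - phi (x + w *: (t *: a)).
  pose df (w : R) := dot (g (x + t *: b + w *: (t *: a)) - g
    (x + w *: (t *: a))) (t *: a).
  have fd (w : R) : 0 <= w <= 1 ->
    is_derive (w : R^o) (1 : R^o) (f : R^o -> R^o) (df w).
    move=> w01; rewrite /df dotBl; apply: is_deriveB; apply: is_derive_line;
      apply: hg.
      by rewrite (le_lt_trans (ball2 _ w01)).
    by rewrite (le_lt_trans (ball1 _ w01))// (le_lt_trans _ tar)//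
      lerDl mulr_ge0// ltW.
  have [] := @MVT_segment R f df 0 1 ler01.
  - by move=> w; rewrite in_itv/= => /andP[/ltW w0 /ltW w1]; apply: fd;
    rewrite w0.
  - apply: derivable_within_continuous => w; rewrite in_itv/= => w01.
    by have [] := fd w w01.
  move=> w; rewrite in_itv/= => w01;
    rewrite subr0 mulr1 /f !scale0r !addr0 !scale1r => E.
  have -> : phi (x + t *: a + t *: b) - phi (x + t *: a) - phi (x + t *: b)
    + phi x = df w.
    by rewrite -E (addrAC x); ring.
  have -> : t ^+ 2 * dot (b *m H) a = dot ((t *: b) *m H) (t *: a).
    by rewrite -scalemxAl dotZl dotZr; ring.
  rewrite /df -dotBl (le_trans (dot_norm_le _ _))//.
  have := gr (x + t *: b + w *: (t *: a)) (x + w *: (t *: a)).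
  rewrite (_ : x + t *: b + w *: (t *: a) - (x + w *: (t *: a)) = t *: b);
    last first.
    by apply/rowP => i; rewrite !mxE; ring.
  rewrite (le_lt_trans (ball2 _ w01) tbr) => /(_ isT).
  rewrite (le_lt_trans (ball1 _ w01)) => [/(_ isT) h|]; last first.
    by rewrite (le_lt_trans _ tbr)// lerDl mulr_ge0// ltW.
  apply: le_trans (_ : d.+1%:R * (e / K * `|t *: b|) * `|t *: a| <= _).
    by rewrite ler_wpM2r// ler_wpM2l.
  rewrite !normrZ gtr0_norm//.
  have -> : d.+1%:R * (e / K * (t * `|b|)) * (t * `|a|) =
    e * t ^+ 2 * ((d.+1%:R * `|a| * `|b|) / K) by ring.
  rewrite ler_piMr ?mulr_ge0 ?sqr_ge0 ?(ltW e0)//.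
  rewrite ler_pdivrMr// mul1r /K ler_pM ?mulr_ge0// ?lerDl//.
  by rewrite ler_wpM2l// lerDl.
have : forall e : R, 0 < e -> `|dot (v *m H) u - dot (u *m H) v| <= e.
  move=> e e0; have e20 : 0 < e / 2 by rewrite divr_gt0.
  near (0 : R)^'+ => t.
  have t0 : 0 < t by near: t; exact: nbhs_right_gt.
  have k1 : `|(phi (x + t *: u + t *: v) - phi (x + t *: u) - phi (x + t *: v)
    + phi x)
      - t ^+ 2 * dot (v *m H) u| <= e / 2 * t ^+ 2.
    by near: t; exact: key.
  have k2 : `|(phi (x + t *: v + t *: u) - phi (x + t *: v) - phi (x + t *: u)
    + phi x)
      - t ^+ 2 * dot (u *m H) v| <= e / 2 * t ^+ 2.
    by near: t; exact: key.
  rewrite (addrAC x (t *: v)) in k2.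
  have : `|(dot (v *m H) u - dot (u *m H) v) * t ^+ 2| <= e * t ^+ 2.
    move: k1 k2; rewrite !ler_norml; lra.
  by rewrite normrM (ger0_norm (sqr_ge0 t)) ler_pM2r// exprn_gt0.
move=> small; apply/eqP; rewrite -subr_eq0 -normr_le0; apply/ler_addgt0Pr =>
  e e0.
by rewrite add0r small.
Unshelve. all: by end_near. Qed.


(** The mean value theorem is applied along the segment to [phi] minus its second-order Taylor
    polynomial; the derivative of this remainder is controlled by the strict differentiability of
    the gradient. *)
Lemma C2_at_taylor phi g x H : C2_at phi g x H -> forall e : R, 0 < e ->
  exists2 r : R, 0 < r & forall h, `|h| < r ->
    `|phi (x + h) - phi x - dot (g x) h - 2^-1 * dot (h *m H) h| <=
      e * `|h| ^+ 2.
Proof.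
move=> C2; have Hsym := C2_at_sym C2; case: C2 => -[r r0 hg] gH e e0.
have [r1 r10 gr] := gH (e / d.+1%:R) (divr_gt0 e0 (ltr0Sn _ _)).
exists (Num.min r r1); first by rewrite lt_min r0.
move=> h; rewrite lt_min => /andP[hr hr1].
have ball1 (c : R) : 0 <= c <= 1 -> `|x + c *: h - x| <= `|h|.
  move=> /andP[c0 c1]; rewrite addrAC subrr add0r !normrZ (ger0_norm c0).
  by rewrite ler_piMl.
pose f (w : R) := phi (x + w *: h)
  - (w * dot (g x) h + w ^+ 2 * (2^-1 * dot (h *m H) h)).
pose df (w : R) := dot (g (x + w *: h)) h - (dot (g x) h + w * dot (h *m H) h).
have fd (w : R) : 0 <= w <= 1 ->
  is_derive (w : R^o) (1 : R^o) (f : R^o -> R^o) (df w).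
  move=> w01; apply: is_deriveB.
    by apply: is_derive_line; apply: hg; rewrite (le_lt_trans (ball1 _ w01)).
  apply: (@is_derive_quadratic _ R^o _ _ _ _ (2^-1 * dot (h *m H) h)) => t.
  by rewrite [t *: (1 : R^o)]mulr1; field.
have [] := @MVT_segment R f df 0 1 ler01.
- by move=> w; rewrite in_itv/= => /andP[/ltW w0 /ltW w1]; apply: fd;
  rewrite w0.
- apply: derivable_within_continuous => w; rewrite in_itv/= => w01.
  by have [] := fd w w01.
move=> w; rewrite in_itv/= => w01;
  rewrite subr0 mulr1 /f scale0r addr0 scale1r => E.
have -> : phi (x + h) - phi x - dot (g x) h - 2^-1 * dot (h *m H) h = df w.
  by rewrite -E; ring.
have -> : df w = dot (g (x + w *: h) - g x - (w *: h) *m H) h.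
  by rewrite /df -scalemxAl !dotBl dotZl; ring.
rewrite (le_trans (dot_norm_le _ _))//.
have := gr (x + w *: h) x.
rewrite (le_lt_trans (ball1 _ w01) hr1) => /(_ isT); rewrite subrr normr0 r10 =>
  /(_ isT).
rewrite (_ : x + w *: h - x = w *: h); last by rewrite addrAC subrr add0r.
move=> hh.
apply: le_trans (_ : d.+1%:R * (e / d.+1%:R * `|w *: h|) * `|h| <= _).
  by rewrite ler_wpM2r// ler_wpM2l.
case/andP: w01 => w0 w1; rewrite normrZ (ger0_norm w0).
have -> : d.+1%:R * (e / d.+1%:R * (w * `|h|)) * `|h| = w * (e * `|h| ^+ 2).
  by field; rewrite nat1r pnatr_eq0.
by rewrite ler_piMl// mulr_ge0 ?sqr_ge0// ltW.
Qed.

Lemma strictly_diffD n (g k : 'rV[R]_d -> 'rV[R]_n) x M N :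
  strictly_diff g x M -> strictly_diff k x N ->
  strictly_diff (fun y => g y + k y) x (M + N).
Proof.
move=> gM kN e e0; have e20 : 0 < e / 2 by rewrite divr_gt0.
have [r r0 gr] := gM _ e20; have [s s0 ks] := kN _ e20.
exists (Num.min r s) => [|p q]; first by rewrite lt_min r0.
rewrite !lt_min => /andP[pr ps] /andP[qr qs].
have -> : g p + k p - (g q + k q) - (p - q) *m (M + N) =
  (g p - g q - (p - q) *m M) + (k p - k q - (p - q) *m N).
  by rewrite mulmxDr; apply/rowP => i; rewrite !mxE; ring.
rewrite (le_trans (ler_normD _ _))// (splitr e) mulrDl lerD//;
  [exact: gr|exact: ks].
Qed.

Lemma strictly_diffZ n (g : 'rV[R]_d -> 'rV[R]_n) x M (c : R) :
  strictly_diff g x M -> strictly_diff (fun y => c *: g y) x (c *: M).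
Proof.
move=> gM e e0; have ec0 : 0 < e / (`|c| + 1) by rewrite divr_gt0// ltr_wpDl.
have [r r0 gr] := gM _ ec0; exists r => // p q pr qr.
rewrite -scalemxAr -!scalerBr normrZ.
apply: le_trans (ler_wpM2l (normr_ge0 c) (gr p q pr qr)) _.
rewrite mulrA ler_wpM2r// mulrA ler_pdivrMr ?ltr_wpDl//.
by rewrite mulrC ler_wpM2l ?lerDl// ltW.
Qed.

Lemma C2_atD phi psi g k x H K : C2_at phi g x H -> C2_at psi k x K ->
  C2_at (fun y => phi y + psi y) (fun y => g y + k y) x (H + K).
Proof.
move=> [[r r0 hg] gH] [[s s0 hk] kK]; split; last exact: strictly_diffD.
exists (Num.min r s) => [|y]; first by rewrite lt_min r0.
by rewrite !lt_min => /andP[yr ys] v; rewrite dotDl; apply: is_deriveD;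
  [exact: hg|exact: hk].
Qed.

Lemma C2_atZ phi g x H (c : R) : C2_at phi g x H ->
  C2_at (fun y => c * phi y) (fun y => c *: g y) x (c *: H).
Proof.
move=> [[r r0 hg] gH]; split; last exact: strictly_diffZ.
by exists r => // y yr v; rewrite dotZl; apply: is_deriveZ; exact: hg.
Qed.

Lemma C2_at_sum m (phi_ : 'I_m -> 'rV[R]_d -> R)
    (g_ : 'I_m -> 'rV[R]_d -> 'rV[R]_d) x (H_ : 'I_m -> 'M[R]_d) (c : 'I_m -> R)
      :
  (forall j, C2_at (phi_ j) (g_ j) x (H_ j)) ->
  C2_at (fun y => \sum_j c j * phi_ j y) (fun y => \sum_j c j *: g_ j y) x
    (\sum_j c j *: H_ j).
Proof.

move=> C2; rewrite (_ : (fun y => \sum_j _) = fun y =>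
  \sum_(j <- index_enum 'I_m) c j * phi_ j y)//.
rewrite (_ : (fun y => \sum_j _) = fun y =>
  \sum_(j <- index_enum 'I_m) c j *: g_ j y)//.
elim: (index_enum _) => [|j s IH].
  rewrite big_nil; split.
    exists 1 => // y _ v; rewrite big_nil dot0l.
    by apply: (@is_derive_quadratic _ _ _ _ _ _ 0) => t; rewrite !big_nil; ring.
  move=> e e0; exists 1 => // p q _ _.
  by rewrite !big_nil mulmx0 !subrr normr0 mulr_ge0// ltW.
rewrite big_cons.
rewrite (_ : (fun y => \sum_(i <- _) _) = fun y =>
  c j * phi_ j y + \sum_(i <- s) c i * phi_ i y); last first.
  by apply/funext => y; rewrite big_cons.
rewrite (_ : (fun y => \sum_(i <- _) _) = fun y =>
  c j *: g_ j y + \sum_(i <- s) c i *: g_ i y); last first.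
  by apply/funext => y; rewrite big_cons.
by apply: C2_atD IH; exact: C2_atZ.
Qed.

End Calculus.

(** * Gradients and Hessians of twice continuously differentiable functions *)

Section SmoothCalculus.
Context {R : realType} {d : nat}.
Implicit Types (x y p q v h : 'rV[R]_d) (phi psi : 'rV[R]_d -> R).

Lemma mulmx_cols n (G : 'I_n -> 'rV[R]_d) v j :
  (v *m \matrix_(i, j) G j 0 i) 0 j = dot (G j) v.
Proof. by rewrite mxE; apply: eq_bigr => i _; rewrite !mxE mulrC. Qed.

Lemma continuous_family_le n (f : 'I_n -> 'rV[R]_d -> R^o) x (e : R) :
  (forall i, {for x, continuous (f i)}) -> 0 < e ->
  exists2 r : R, 0 < r & forall z, `|z - x| < r -> forall i, `|f i z - f i x| <=
    e.
Proof.
move=> fc e0; apply/(rV_nearP x (fun z => forall i, `|f i z - f i x| <= e)).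
apply: (@filter_forall _ _ _ (nbhs x) (nbhs_filter x)) => i.
have /cvgrPdist_le/(_ e e0) fe := fc i;
  apply: (@filterS _ _ (nbhs_filter x) _ _ _ fe) => z.
by rewrite distrC.
Qed.

Lemma Cp_on_has_grad (W : set 'rV[R]_d) phi x : open W -> W x ->
  (forall y, W y -> differentiable (phi : _ -> R^o) y) ->
  exists2 r : R, 0 < r & (forall y, `|y - x| < r -> W y) /\
    has_grad phi (fun y => \row_i 'D_(delta_mx 0 i) (phi : _ -> R^o) y) x r.
Proof.
move=> oW Wx dphi; have /rV_nearP[r r0 rW] : \forall y \near x, W y.
  exact: open_nbhs_nbhs.
exists r => //; split => // y yr v.
have dy : differentiable (phi : _ -> R^o) y by apply/dphi/rW.
have -> : dot (\row_i 'D_(delta_mx 0 i) (phi : _ -> R^o) y) v =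
  'D_v (phi : _ -> R^o) y.
  rewrite deriveE// [in RHS](row_sum_delta v) linear_sum; apply: eq_bigr => i _.
  by rewrite mxE deriveE// linearZ/= mulrC.
by apply: derivableP; exact: diff_derivable.
Qed.

(** Each first partial derivative has continuous partial derivatives, so it is strictly
    differentiable by [grad_strict]. The finitely many radii are then merged into one. *)
Lemma Cp_on_C2_at (W : set 'rV[R]_d) phi x : open W -> W x ->
  Cp_on 2 W (phi : _ -> R^o) ->
  exists H, C2_at phi (fun y => \row_i 'D_(delta_mx 0 i) (phi : _ -> R^o) y) x
    H.
Proof.
move=> oW Wx [dphi dd].
have [r r0 [rW hg]] := Cp_on_has_grad oW Wx dphi.
pose psi j := 'D_(delta_mx 0 j) (phi : _ -> R^o).
pose G j := fun y => \row_i 'D_(delta_mx 0 i) (psi j) y.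
exists (\matrix_(i, j) G j x 0 i); split; first by exists r.
have C1 j (e : R) : 0 < e -> exists2 r : R, 0 < r & forall p q,
    `|p - x| < r -> `|q - x| < r ->
    `|psi j p - psi j q - dot (G j x) (p - q)| <= e * `|p - q|.
  move=> e0; have [dpsi cpsi] := dd (delta_mx 0 j).
  have [s s0 [sW hs]] := Cp_on_has_grad oW Wx dpsi.
  have ed0 : 0 < e / d.+1%:R by rewrite divr_gt0.
  have [t t0 tG'] := continuous_family_le (fun i => cpsi (delta_mx 0 i) x Wx)
    ed0.
  have tG z : `|z - x| < t -> `|G j z - G j x| <= e / d.+1%:R.
    move=> zt; apply/rV_norm_leP => [|i]; first exact: ltW.
    by rewrite !mxE; exact: tG'.
  exists (Num.min s t) => [|p q]; first by rewrite lt_min s0.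
  move=> ps qs; have -> : e = d.+1%:R * (e / d.+1%:R).
    by field; rewrite nat1r pnatr_eq0.
  apply: grad_strict ps qs; first by rewrite divr_ge0// ltW.
    by move=> y; rewrite lt_min => /andP[ys _]; exact: hs.
  by move=> z; rewrite lt_min => /andP[_]; exact: tG.
move=> e e0.
have : \forall t \near 0^'+, forall j p q, `|p - x| < t -> `|q - x| < t ->
    `|psi j p - psi j q - dot (G j x) (p - q)| <= e * `|p - q|.
  apply: filter_forall => j; have [s s0 sG] := C1 j e e0.
  near=> t => p q pt qt; have ts : t <= s by near: t; exact: nbhs_right_le.
  by apply: sG; exact: lt_le_trans ts.
move=> near_t; near (0 : R)^'+ => t.
exists t => // p q pt qt; apply/rV_norm_leP => [|j]; first by rewrite mulr_ge0//
  ltW.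
have : `|psi j p - psi j q - dot (G j x) (p - q)| <= e * `|p - q|.
  by move: j p q pt qt; near: t.
rewrite -(mulmx_cols (fun j => G j x)).
have mxB (A B C : 'rV[R]_d) : (A - B - C) 0 j =
  A 0 j - B 0 j - C 0 j by rewrite !mxE.
have rowE f : (\row_i f i : 'rV[R]_d) 0 j = f j by rewrite mxE.
by rewrite mxB !rowE.
Unshelve. all: by end_near. Qed.

End SmoothCalculus.

(** * Lagrange multipliers *)

Section Lagrange.
Context {R : realType} {d : nat}.
Implicit Types (x y p q v h : 'rV[R]_d) (phi psi : 'rV[R]_d -> R)
  (g : 'rV[R]_d -> 'rV[R]_d).

Lemma has_grad_lip phi g x (r C : R) : 0 <= C -> 0 < r -> has_grad phi g x r ->
  (forall z, `|z - x| < r -> `|g z - g x| <= C * `|z - x|) ->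
  exists2 K : R, 0 < K & forall p q, `|p - x| < r -> `|q - x| < r ->
    `|phi p - phi q| <= K * `|p - q|.
Proof.
move=> C0 r0 hg gC; exists (1 + d.+1%:R * (C * r) + d.+1%:R * `|g x|).
  by rewrite -addrA ltr_wpDr// addr_ge0 ?mulr_ge0// ltW.
move=> p q px qx; rewrite -(subrK (dot (g x) (p - q)) (phi p - phi q)).
rewrite (le_trans (ler_normD _ _))// mulrDl lerD ?dot_norm_le//.
apply: le_trans (_ : d.+1%:R * (C * r) * `|p - q| <= _).
  apply: grad_strict px qx => //; first by rewrite mulr_ge0// ltW.
  move=> z zr; rewrite (le_trans (gC _ zr))// ler_wpM2l// ltW//.
by rewrite ler_wpM2r// lerDr.
Qed.

Lemma lip_continuous phi x (r K : R) : 0 < K ->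
  (forall p q, `|p - x| < r -> `|q - x| < r ->
    `|phi p - phi q| <= K * `|p - q|) ->
  forall y, `|y - x| < r -> {for y, continuous (phi : _ -> R^o)}.
Proof.
move=> K0 lip y yr; apply/(@cvgrPdist_le _ _ _ (nbhs y) (nbhs_filter y)) =>
  e e0.
apply/(rV_nearP y (fun t => `|phi y - phi t| <= e)).
exists (Num.min (r - `|y - x|) (e / K)) => [|z].
  by rewrite lt_min subr_gt0 yr divr_gt0.
rewrite lt_min => /andP[zr zK]; rewrite (le_trans (lip _ _ _ _))//.
  by rewrite -(subrK y z) -addrA (le_lt_trans (ler_normD _ _))// -ltrBrDr.
by rewrite mulrC -ler_pdivlMr// distrC ltW.
Qed.

Lemma is_derive_dist p y v :
  is_derive y v ((fun z => dot (z - p) (z - p)) : _ -> R^o) (2 * dot (y - p) v).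
Proof.
apply: (@is_derive_quadratic _ _ _ _ _ _ (dot v v)) => t.
rewrite -addrA; move: (y - p) => w.
rewrite dotDl !dotDr !(dotZl, dotZr) (dotC v w); ring.
Qed.

Lemma is_derive_approx (f : 'rV[R]_d -> R^o) y v a : is_derive y v f a ->
  forall e : R, 0 < e -> exists2 r : R, 0 < r & forall t, `|t| < r ->
    `|f (y + t *: v) - f y - t * a| <= e * `|t|.
Proof.
move=> [fd fE] e e0.
have : (fun h : R => h^-1 *: ((f \o shift y) (h *: v) - f y : R^o)) @ 0^' -->
  (a : R^o).
  by rewrite -fE; exact: fd.
move=> /cvgrPdist_le/(_ e e0); rewrite near_withinE => /nbhs_ballP[r /= r0 rP].
exists r => // t tr; have [->|t0] := eqVneq t 0.
  by rewrite scale0r addr0 mul0r !subrr normr0 mulr0.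
have := rP t; rewrite -ball_normE /= sub0r normrN => /(_ tr t0).
move=> h.
have -> : f (y + t *: v) - f y - t * a =
  - ((a - t^-1 * (f (t *: v + y) - f y)) * t).
  by rewrite (addrC y); field.
rewrite normrN normrM ler_wpM2r//; exact: h.
Qed.

Lemma directional_min (f : 'rV[R]_d -> R^o) y (s a : R) v : 0 < s ->
  (forall z, `|z - y| < s -> f y <= f z) -> is_derive y v f a -> a = 0.
Proof.
move=> s0 fmin /is_derive_approx fd.
apply/eqP; rewrite -normr_le0; apply/ler_addgt0Pr => e e0; rewrite add0r.
have [r r0 fr] := fd e e0.
pose t := Num.min r (s / (`|v| + 1)) / 2.
have t0 : 0 < t by rewrite divr_gt0// lt_min r0 divr_gt0// ltr_wpDl.
have tr : t < Num.min r (s / (`|v| + 1)).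
  by rewrite /t ltr_pdivrMr// ltr_pMr ?ltr1n// lt_min r0 divr_gt0// ltr_wpDl.
have /andP[tr1 ts] : (t < r) && (t < s / (`|v| + 1)) by rewrite -lt_min.
have tv : `|t *: v| < s.
  rewrite normrZ gtr0_norm// (le_lt_trans _ (_ : t * (`|v| + 1) < s))//.
    by rewrite ler_pM2l// lerDl.
  by rewrite -ltr_pdivlMr// ltr_wpDl.
have fp : f y <= f (y + t *: v) by apply: fmin; rewrite addrC addKr.
have fm : f y <= f (y + (- t) *: v).
  by apply: fmin; rewrite addrC addKr scaleNr normrN.
have hp := fr t; have hm := fr (- t); rewrite ?normrN gtr0_norm// in hp hm.
move: (hp tr1) (hm tr1); rewrite ler_norml => /andP[_ h1].
rewrite ler_norml => /andP[_ h2].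
rewrite -(ler_pM2l t0) -{1}(gtr0_norm t0) -normrM ler_norml; lra.
Qed.

(** Minimize [phi] plus [k] times the squared constraints plus $|y-p|^2$ over the ball of radius
    [s]. As [k] grows the minimizers cluster only at [p], because the last term makes [p] the strict
    constrained minimum. So some minimizer is interior, hence stationary. *)
Lemma penalty_stationary m phi g (G_ : 'I_m -> 'rV[R]_d -> R)
    (g_ : 'I_m -> 'rV[R]_d -> 'rV[R]_d) p (r C s : R) :
  0 < r -> 0 <= C -> has_grad phi g p r ->
    (forall j, has_grad (G_ j) (g_ j) p r) ->
  (forall y, `|y - p| < r -> `|g y - g p| <= C * `|y - p|) ->
  (forall j y, `|y - p| < r -> `|g_ j y - g_ j p| <= C * `|y - p|) ->
  (forall j, G_ j p = 0) ->
  (forall y, `|y - p| < r -> (forall j, G_ j y = 0) -> phi p <= phi y) ->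
  0 < s < r ->
  exists y, `|y - p| < s /\
    exists l : 'rV[R]_m, g y + \sum_j l 0 j *: g_ j y + 2 *: (y - p) = 0.
Proof.
move=> r0 C0 hg hgj gC gjC Gp pmin /andP[s0 sr].
have [K K0 lip] := has_grad_lip C0 r0 hg gC.
have phi_cont y : `|y - p| < r -> {for y, continuous (phi : _ -> R^o)}.
  exact: lip_continuous lip _.
have G_cont j y : `|y - p| < r -> {for y, continuous (G_ j : _ -> R^o)}.
  have [Kj Kj0 lipj] := has_grad_lip C0 r0 (hgj j) (gjC j).
  exact: lip_continuous lipj _.
pose S y := \sum_j G_ j y ^+ 2.
have S_cont y : `|y - p| < r -> {for y, continuous (S : _ -> R^o)}.
  move=> yr; apply: (cvg_big add_continuous _ (F := nbhs y)) => j _.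
  have FF : Filter (nbhs y) := nbhs_filter y.
  by apply: cvgM; exact: G_cont.
pose D y := dot (y - p) (y - p).
pose Phi (k : nat) y := phi y + k%:R * S y + D y.
have Phi_cont k y : `|y - p| < r -> {for y, continuous (Phi k : _ -> R^o)}.
  move=> yr; have FF : Filter (nbhs y) := nbhs_filter y.
  apply: (cvgD (F := nbhs y)); last exact: dot_continuous.
  apply: (cvgD (F := nbhs y)); first exact: phi_cont.
  by apply: (cvgMl_tmp (F := nbhs y)); exact: S_cont.
have S0 y : 0 <= S y by apply: sumr_ge0 => j _; rewrite sqr_ge0.
have Sp : S p = 0 by rewrite /S big1// => j _; rewrite Gp expr0n.
have Phip k : Phi k p = phi p by rewrite /Phi Sp mulr0 /D subrr dot0l !addr0.
pose A : set 'rV[R]_d := [set y | `|y - p| <= s].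
have Ap : A p by rewrite /A /= subrr normr0 ltW.
have cA : compact A by exact: closed_ball_compact.
have Ar y : A y -> `|y - p| < r by move=> ys; exact: le_lt_trans sr.
have /choice[y_ y_min] : forall k : nat, exists y, A y /\ forall z, A z ->
  Phi k y <= Phi k z.
  move=> k; have [||y] := @EVT_min_rV R d (Phi k) A _ cA; first by exists p.
    apply: continuous_in_subspaceT => y; rewrite inE => /Ar; exact: Phi_cont.
  rewrite inE => Ay ymin; exists y; split => // z Az; apply: ymin;
    exact: mem_set.
have Phi_le k : phi (y_ k) + k%:R * S (y_ k) + D (y_ k) <= phi p.
  by rewrite -(Phip k); have [_] := y_min k; exact.
have D0 y : 0 <= D y by exact: dot_ge0.
have [q [Aq clq]] : A `&` cluster (y_ @ \oo) !=set0.
  by apply: cA; exists 0%N => // k _; have [] := y_min k.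
have frequently (B : set 'rV[R]_d) k0 : nbhs q B -> exists2 k,
  (k0 <= k)%N & B (y_ k).
  move=> qB; have [|z [[k k0k <-] Bk]] :=
    clq [set y_ k | k in [set k | (k0 <= k)%N]] B _ qB.
    by exists k0 => // k /= k0k; exists k.
  by exists k.
have near_q (e : R) : 0 < e -> \forall z \near q,
    `|S q - S z| <= e /\ `|phi q + D q - (phi z + D z)| <= e.
  move=> e0; have FF : Filter (nbhs q) := nbhs_filter q.
  have /(@cvgrPdist_le _ _ _ (nbhs q) FF)/(_ e e0) Se := S_cont q (Ar _ Aq).
  have : {for q, continuous ((fun z => phi z + D z) : _ -> R^o)}.
    apply: (cvgD (F := nbhs q)); last exact: dot_continuous.
    exact: phi_cont (Ar _ Aq).
  move=> /(@cvgrPdist_le _ _ _ (nbhs q) FF)/(_ e e0) phie.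
  exact: (@filterI _ _ FF _ _ Se phie).
have phi_q : phi q + D q <= phi p.
  apply/ler_addgt0Pr => e e0; have [k _ [_]] := frequently _ 0%N (near_q e e0).
  rewrite ler_norml; have := Phi_le k; have : 0 <=
    k%:R * S (y_ k) by rewrite mulr_ge0.
  lra.
(* Minimality bounds [k%:R * S (y_ k)] by [phi p - phi (y_ k)], which is at most [K * s]; so
   [S (y_ k)] tends to 0. *)
have S_q : S q = 0.
  apply/eqP; rewrite eq_le S0 andbT; apply/ler_addgt0Pr => e e0; rewrite add0r.
  have e20 : 0 < e / 2 by rewrite divr_gt0.
  pose k0 := (Num.truncn (K * s / (e / 2))).+1.
  have [k k0k [+ _]] := frequently _ k0 (near_q _ e20).
  have Ak : A (y_ k) by have [] := y_min k.
  have kpos : 0 < k%:R :> R by rewrite ltr0n; exact: leq_trans k0k.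
  have Kk : K * s < k%:R * (e / 2).
    rewrite -ltr_pdivrMr// (lt_le_trans (truncnS_gt _))// ler_nat//.
  have philow : phi p - phi (y_ k) <= K * s.
    rewrite (le_trans (ler_norm _))// (le_trans (lip _ _ _ _))//
      ?subrr ?normr0//.
      exact: Ar.
    by rewrite ler_pM2l// distrC.
  have : k%:R * S (y_ k) < k%:R * (e / 2).
    apply: le_lt_trans Kk; have := Phi_le k; have := D0 (y_ k); lra.
  rewrite ltr_pM2l// ler_norml; lra.
have Gq j : G_ j q = 0.
  apply/eqP; rewrite -sqrf_eq0; apply/eqP.
  have /psumr_eq0P : forall i : 'I_m, true -> 0 <= G_ i q ^+ 2 by move=> i _;
    rewrite sqr_ge0.
  by move=> /(_ S_q); exact.
(* The point [q] is feasible, so [phi p <= phi q]; with [phi_q] this leaves no room for a positive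
   [D q]. *)
have qp : q = p.
  apply/eqP; rewrite -subr_eq0; apply/eqP/dot_eq0/eqP; rewrite eq_le D0 andbT.
  by have := pmin q (Ar _ Aq) Gq; move: phi_q; rewrite /D; lra.
have [k _ yk] : exists2 k, (0 <= k)%N & `|y_ k - p| < s.
  by apply: (frequently (fun y => `|y - p| < s)); rewrite qp; apply/rV_nearP;
    exists s.
have [Ak kmin] := y_min k; set y := y_ k in yk Ak kmin *.
(* These multipliers are the coefficients in the gradient of the penalty. *)
exists y; split => //; exists (\row_j (2 * k%:R * G_ j y)).
set u := _ + _; apply: dot_eq0.
have yr := Ar _ Ak.
suff deriv v : is_derive y v (Phi k : _ -> R^o) (dot u v).
  apply: (@directional_min _ _ (s - `|y - p|) _ _ _ _ (deriv u)); first
    by rewrite subr_gt0.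
  move=> z zy; apply: kmin; rewrite /A /= -(subrK y z) -addrA.
  by rewrite (le_trans (ler_normD _ _))//; lra.
have -> : dot u v = dot (g y) v + k%:R * (\sum_j 2 * G_ j y * dot (g_ j y) v)
  + 2 * dot (y - p) v.
  rewrite /u (dotDl (g y + _)) (dotDl (g y)) dotZl dot_suml; congr (_ + _ + _).
  rewrite [RHS]mulr_sumr.
  by apply: eq_bigr => j _; rewrite dotZl mxE; ring.
suff dS : is_derive y v (S : _ -> R^o) (\sum_j 2 * G_ j y * dot (g_ j y) v).
  exact: (is_deriveD (is_deriveD (hg y yr v) (is_deriveZ k%:R dS))
    (is_derive_dist p y v)).
rewrite (_ : S = \sum_j (fun z => G_ j z ^+ 2)); last first.
  by apply/funext => z; rewrite fct_sumE.
apply: is_derive_sum => j.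
have := @is_deriveM _ _ (G_ j) (G_ j) y v _ _ (hgj j y yr v) (hgj j y yr v).
rewrite (_ : (_ * _) = (fun z => G_ j z ^+ 2)); last by apply/funext => z;
  rewrite expr2.
by move=> h; apply: (is_derive_eq h); rewrite /GRing.scale/=; ring.
Qed.


(** The stationary points of the penalized problems approach [p], and independence of the gradients
    bounds their multipliers. So [g p] is arbitrarily close to the span of the [g_ j p]; the matrix
    [B], which reads off coefficients, produces the exact combination without extracting a limit of
    multipliers. *)
Lemma lagrange_multiplier m phi g (G_ : 'I_m -> 'rV[R]_d -> R)
    (g_ : 'I_m -> 'rV[R]_d -> 'rV[R]_d) p (r C : R) :
  0 < r -> 0 <= C -> has_grad phi g p r ->
    (forall j, has_grad (G_ j) (g_ j) p r) ->
  (forall y, `|y - p| < r -> `|g y - g p| <= C * `|y - p|) ->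
  (forall j y, `|y - p| < r -> `|g_ j y - g_ j p| <= C * `|y - p|) ->
  (forall j, G_ j p = 0) ->
  (forall y, `|y - p| < r -> (forall j, G_ j y = 0) -> phi p <= phi y) ->
  (forall l : 'rV[R]_m, \sum_j l 0 j *: g_ j p = 0 -> l = 0) ->
  exists l : 'rV[R]_m, g p = \sum_j l 0 j *: g_ j p.
Proof.
move=> r0 C0 hg hgj gC gjC Gp pmin inj.
have [B gB] := independent_right_inverse inj.
exists (g p *m B); apply/eqP; rewrite -subr_eq0 -normr_le0.
pose N : 'M[R]_(m, d) := \matrix_j g_ j p.
have NE (l : 'rV[R]_m) : \sum_j l 0 j *: g_ j p = l *m N.
  by rewrite mulmx_sum_row; apply: eq_bigr => j _; rewrite rowK.
have NB (l : 'rV[R]_m) : l *m N *m B = l by rewrite -NE gB.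
rewrite NE.
pose b := d.+1%:R * `|B| : R; have b0 : 0 <= b by rewrite mulr_ge0.
pose b' := d.+1%:R * `|B *m N| : R; have b'0 : 0 <= b' by rewrite mulr_ge0.
pose c := m%:R * C * b; have c0 : 0 <= c by rewrite !mulr_ge0.
pose c1 := c * `|g p| + C + 2.
have c10 : 0 < c1 by rewrite ltr_wpDl// addr_ge0// mulr_ge0.
apply/ler_addgt0Pr => e e0; rewrite add0r.
(* The second bound gives [s * c <= 2^-1], so that [u2] can be solved for the norm of [u]; the third
   makes the final error at most [e]. *)
pose s := Num.min (r / 2) (Num.min ((2 * (c + 1))^-1)
  (e / (2 * c1 * (1 + b')))).
have den0 : 0 < 2 * c1 * (1 + b') by rewrite !mulr_gt0// ltr_wpDr.
have s0 : 0 < s.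
  by rewrite !lt_min !divr_gt0//= invr_gt0 mulr_gt0// ltr_wpDl.
have [sr] : s <= r / 2 /\ s <=
  Num.min ((2 * (c + 1))^-1) (e / (2 * c1 * (1 + b'))).
  by apply/andP; rewrite -le_min.
rewrite le_min => /andP[sc se].
have s0r : 0 < s < r by rewrite s0 (le_lt_trans sr)// ltr_pdivrMr// ltr_pMr//
  ltr1n.
have [y [ys [l El]]] := penalty_stationary r0 C0 hg hgj gC gjC Gp pmin s0r.
have yr : `|y - p| < r by case/andP: s0r => _; exact: lt_trans.
pose u := l *m N + g p.
have uE : u = \sum_j l 0 j *: (g_ j p - g_ j y) + (g p - g y) - 2 *: (y - p).
  under eq_bigr do rewrite scalerBr.
  rewrite sumrB /u -NE; move: El.
  move: (\sum_j l 0 j *: g_ j p) (\sum_j l 0 j *: g_ j y) => X Y El.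
  by rewrite -[LHS]subr0 -El; apply/rowP => i; rewrite !mxE; ring.
have Cs : C * `|y - p| <= C * s by rewrite ler_wpM2l// ltW.
have u1 : `|u| <= s * (m%:R * C * `|l| + C + 2).
  rewrite uE (le_trans (ler_normB _ _))//
    (le_trans (lerD (ler_normD _ _) (lexx _)))//.
  have h1 : `|\sum_j l 0 j *: (g_ j p - g_ j y)| <= m%:R * (C * s) * `|l|.
    apply: norm_scaled_sum_le => [|j]; first by rewrite mulr_ge0// ltW.
    by rewrite distrC (le_trans (gjC _ _ yr)).
  have h2 : `|g p - g y| <= C * s by rewrite distrC (le_trans (gC _ yr)).
  have h3 : `|2 *: (y - p)| <= 2 * s by rewrite normrZ ger0_norm// ler_pM2l//
    ltW.
  lra.
have lB : l = (u - g p) *m B by rewrite /u addrK NB.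
have l1 : `|l| <= b * (`|u| + `|g p|).
  rewrite {1}lB (le_trans (mulmx_norm_le _ _))// -/b ler_wpM2l//.
  exact: ler_normB.
have u2 : `|u| <= s * (c * `|u| + c1).
  apply: (le_trans u1); rewrite ler_wpM2l ?(ltW s0)// /c1.
  have := ler_wpM2l (mulr_ge0 (ler0n R m) C0) l1; rewrite /c; lra.
have u3 : `|u| <= 2 * s * c1.
  have : s * c <= 2^-1.
    rewrite (le_trans (ler_wpM2r c0 sc))// invfM -mulrA ler_piMr ?invr_ge0//.
    by rewrite mulrC ler_pdivrMr ?ltr_wpDl// mul1r lerDl.
  move=> /(ler_wpM2r (normr_ge0 u)); lra.
have -> : g p - g p *m B *m N = u - u *m (B *m N).
  rewrite /u mulmxDl !mulmxA NB opprD.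
  by apply/rowP => i; rewrite !mxE; ring.
rewrite (le_trans (ler_normB _ _))//.
apply: (le_trans (lerD (lexx _) (mulmx_norm_le _ _))); rewrite -/b'.
have : `|u| * (1 + b') <= 2 * s * c1 * (1 + b').
  by rewrite ler_wpM2r// addr_ge0.
have : s * (2 * c1 * (1 + b')) <= e by rewrite -ler_pdivlMr.
lra.
Qed.

End Lagrange.

(** * Escape from a fixed point *)

Section Escape.
Context {R : realType} {d : nat}.
Implicit Types (x y p q v w e : 'rV[R]_d) (A D : 'M[R]_d).

(** Among [d.+1] distinct candidates in the interval, one is not a root of the characteristic
    polynomial, which has degree [d]. *)
Lemma exists_non_eigenvalue A (b : R) : 1 < b ->
  exists2 beta : R, 1 < beta < b & row_free (A - beta%:M).
Proof.
move=> b1; pose beta (i : nat) := 1 + (b - 1) / i.+2%:R.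
have b10 : b - 1 != 0 by rewrite subr_eq0 gt_eqF.
have betaI : injective beta.
  by move=> i j /addrI /(mulfI b10) /invr_inj /eqP; rewrite eqr_nat => /eqP[].
have [i Ai] : exists i : 'I_d.+1, ~~ root (char_poly A) (beta i).
  apply/existsP; rewrite -negb_forall; apply/negP => /forallP H.
  have := @max_poly_roots _ (char_poly A) [seq beta i | i : 'I_d.+1].
  rewrite -size_poly_eq0 size_char_poly size_map -cardE card_ord ltnn =>
    /(_ isT).
  have -> : all (root (char_poly A)) [seq beta i | i : 'I_d.+1].
    by apply/allP => _ /mapP[i _ ->]; exact: H.
  move=> /(_ isT); rewrite map_inj_uniq ?enum_uniq => [/(_ isT)//|i j].
  by move=> /betaI /val_inj.
exists (beta i).
  rewrite ltrDl divr_gt0 ?subr_gt0//= -ltrBrDl ltr_pdivrMr//.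
  by rewrite ltr_pMr ?subr_gt0// ltr1n.
move: Ai; rewrite -eigenvalue_root_char /eigenvalue negbK => /eqP kA.
by rewrite -kermx_eq0; apply/eqP.
Qed.

Lemma quad_expand D u v (t : R) : D^T = D ->
  dot ((u + t *: v) *m D) (u + t *: v) =
  dot (u *m D) u + 2 * t * dot (v *m D) u + t ^+ 2 * dot (v *m D) v.
Proof.
move=> Dsym; rewrite mulmxDl -scalemxAl !dotDl !dotDr !(dotZl, dotZr).
have -> : dot (u *m D) v = dot (v *m D) u by rewrite dotC dot_mulmxr Dsym.
ring.
Qed.

(** Write [w = u + t *: v], where [u] is the projection of [w] along [v] onto the hyperplane of
    vanishing [i]-th coordinate. The form is positive on [v], so it can be nonpositive on [w] only
    if [t] is at most a constant times the norm of [u]. *)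
Lemma quad_cone_bound D v i : D^T = D -> 0 < dot (v *m D) v -> v 0 i != 0 ->
  exists2 c : R, 0 < c & forall w, dot (w *m D) w <= 0 ->
    c * `|w| <= `|w - (w 0 i / v 0 i) *: v|.
Proof.
move=> Dsym; set q := dot (v *m D) v => q0 vi.
pose M1 := d.+1%:R * (d.+1%:R * `|D|) : R.
pose M2 := d.+1%:R * `|v *m D| : R.
have M10 : 0 <= M1 by rewrite !mulr_ge0.
have M20 : 0 <= M2 by rewrite !mulr_ge0.
pose K := (M1 + 2 * M2 + q) / q.
have K0 : 0 < K by rewrite divr_gt0// ltr_wpDl// addr_ge0// mulr_ge0.
have Kv0 : 0 < 1 + K * `|v| by rewrite ltr_wpDr// mulr_ge0// ltW.
exists (1 + K * `|v|)^-1; first by rewrite invr_gt0.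
move=> w Qw; set t := w 0 i / v 0 i; set u := w - t *: v.
have wE : w = u + t *: v by rewrite subrK.
rewrite ler_pdivrMl// {1}wE (le_trans (ler_normD _ _))//
  mulrDl mul1r lerD2l normrZ.
rewrite mulrAC ler_wpM2r//.
have QE : dot (w *m D) w = dot (u *m D) u + 2 * t * dot (v *m D) u + t ^+ 2 * q.
  by rewrite wE quad_expand.
have Q1 : `|dot (u *m D) u| <= M1 * `|u| ^+ 2.
  rewrite (le_trans (dot_norm_le _ _))// /M1 expr2 !mulrA ler_wpM2r//
    -!mulrA ler_wpM2l//.
  by rewrite mulrA mulmx_norm_le.
have Q2 : `|dot (v *m D) u| <= M2 * `|u| by exact: dot_norm_le.
have Qt : t ^+ 2 * q <= M1 * `|u| ^+ 2 + 2 * `|t| * (M2 * `|u|).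
  have : `|2 * t * dot (v *m D) u| <= 2 * `|t| * (M2 * `|u|).
    by rewrite !normrM ger0_norm// ler_wpM2l// mulr_ge0.
  move: Qw Q1; rewrite QE !ler_norml; lra.
(* If [t] exceeded [K] times the norm of [u], then $|u|\le|t|$ because [K] is at least 1, and
   dividing [Qt] by $|t|$ would contradict the choice of [K]. *)
rewrite leNgt; apply/negP => tK.
have ut : `|u| <= `|t|.
  apply: le_trans (ltW tK); rewrite ler_peMl// /K ler_pdivlMr// mul1r lerDr.
  by rewrite addr_ge0// mulr_ge0.
have t0 : 0 < `|t| by rewrite (le_lt_trans _ tK)// mulr_ge0// ltW.
have : `|t| * (`|t| * q) <= `|t| * ((M1 + 2 * M2) * `|u|).
  rewrite mulrA -expr2 real_normK ?num_real// (le_trans Qt)//.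
  have : M1 * `|u| ^+ 2 <= M1 * (`|t| * `|u|) by rewrite expr2 ler_wpM2l//
    ler_wpM2r.
  lra.
rewrite ler_pM2l//; move: tK; rewrite /K mulrAC ltr_pdivrMr//.
have : 0 <= q * `|u| by rewrite mulr_ge0// ltW.
lra.
Qed.

Lemma bernoulli_unbounded (b M : R) : 1 < b -> exists k : nat, M < b ^+ k.
Proof.
move=> b1; have b10 : 0 < b - 1 by rewrite subr_gt0.
have bk k : 1 + k%:R * (b - 1) <= b ^+ k.
  elim: k => [|k IH]; first by rewrite mul0r addr0 expr0.
  rewrite exprS -natr1; have b0 : 0 <= b by rewrite ltW// (lt_trans _ b1).
  apply: le_trans (ler_wpM2l b0 IH).
  have : 0 <= k%:R * (b - 1) * (b - 1) by rewrite !mulr_ge0// ltW.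
  lra.
exists (Num.truncn (M / (b - 1))).+1; apply: lt_le_trans (bk _).
by rewrite ltr_wpDl// -ltr_pdivrMr// truncnS_gt.
Qed.

(** For [v = w *m A] the inequality holds with a surplus: it is at least $|wD|^2$ since [A] is
    positive semidefinite and [beta] is at least 1, and this is at least a multiple of $|w|^2$ since
    [D] is invertible. The surplus absorbs the error made by replacing [w *m A] by a nearby [v]. *)
Lemma cone_expansion A (beta : R) : A^T = A ->
  (forall w, 0 <= dot (w *m A) w) ->
  1 <= beta -> row_free (A - beta%:M) ->
  exists2 e : R, 0 < e & forall w v, `|v - w *m A| <= e * `|w| ->
    beta ^+ 2 * dot (w *m (A - beta%:M)) w <= dot (v *m (A - beta%:M)) v.
Proof.
move=> Asym Apos beta1 /row_freeP[D' DD']; set D := A - beta%:M in DD' *.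
have Dsym : D^T = D by rewrite /D linearB/= Asym tr_scalar_mx.
pose c := d.+1%:R * `|D'| + 1 : R.
have c0 : 0 < c by rewrite ltr_wpDl// mulr_ge0.
have wD w : `|w| <= c * `|w *m D|.
  rewrite -{1}(mulmx1 w) -DD' mulmxA (le_trans (mulmx_norm_le _ _))//.
  by rewrite ler_wpM2r// lerDl.
(* A D A - beta^2 D = D A D + beta D D, since A = D + beta *)
have ident w : dot ((w *m A) *m D) (w *m A) =
    beta ^+ 2 * dot (w *m D) w + (dot ((w *m D) *m A) (w *m D) + beta * dot
      (w *m D) (w *m D)).
  have AE u : u *m A = u *m D + beta *: u.
    by rewrite /D mulmxBr mul_mx_scalar subrK.
  rewrite !AE mulmxDl -scalemxAl; move aE : (w *m D) => a.
  rewrite !dotDl !dotDr !(dotZl, dotZr).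
  have -> : dot (a *m D) w = dot a a by rewrite dotC dot_mulmxr Dsym aE.
  ring.
pose M := 2 * (d.+1%:R * (d.+1%:R * `|A *m D|)) + d.+1%:R * (d.+1%:R * `|D|)
  : R.
have M0 : 0 <= M by rewrite addr_ge0// !mulr_ge0.
(* The bound 1 makes the error [u] no larger than [w], so that its quadratic term is also linear in
   [e]; the other bound makes [M * e] at most $c^{-2}$, the size of the surplus. *)
exists (Num.min 1 ((M + 1) * c ^+ 2)^-1).
  by rewrite lt_min ltr01 invr_gt0 mulr_gt0 ?exprn_gt0// ltr_wpDl.
move=> w v; set e := Num.min _ _ => vw; set u := v - w *m A in vw.
have e0 : 0 <= e by rewrite le_min ler01 invr_ge0 mulr_ge0 ?exprn_ge0
  ?(ltW c0)// addr_ge0.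
have vE : v = w *m A + u by rewrite addrC subrK.
have uw : `|u| <= `|w|.
  by rewrite (le_trans vw)// ler_piMl// ge_min lexx.
have -> : dot (v *m D) v = dot ((w *m A) *m D) (w *m A) + 2 * dot
  ((w *m A) *m D) u + dot (u *m D) u.
  rewrite vE -{1 2}(scale1r u) quad_expand// mulr1 expr1n mul1r;
    congr (_ + _ * _ + _).
  by rewrite dotC dot_mulmxr Dsym.
have E1 : `|dot ((w *m A) *m D) u| <=
  d.+1%:R * (d.+1%:R * `|A *m D|) * e * `|w| ^+ 2.
  rewrite (le_trans (dot_norm_le _ _))// -mulmxA expr2.
  have := mulmx_norm_le w (A *m D); set X := `|w *m _| => X1.
  apply: le_trans (_ : d.+1%:R * (d.+1%:R * `|A *m D| * `|w|) * (e * `|w|) <=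
    _); last first.
    by rewrite le_eqVlt; apply/orP; left; apply/eqP; ring.
  by rewrite ler_pM ?ler_wpM2l// mulr_ge0// normr_ge0.
have E2 : `|dot (u *m D) u| <= d.+1%:R * (d.+1%:R * `|D|) * e * `|w| ^+ 2.
  rewrite (le_trans (dot_norm_le _ _))// expr2.
  have := mulmx_norm_le u D; set X := `|u *m _| => X1.
  apply: le_trans (_ : d.+1%:R * (d.+1%:R * `|D| * (e * `|w|)) * `|w| <= _);
    last first.
    by rewrite le_eqVlt; apply/orP; left; apply/eqP; ring.
  by rewrite ler_pM ?ler_wpM2l ?mulr_ge0 ?normr_ge0// (le_trans X1)//
    ler_wpM2l// mulr_ge0.
have E3 : M * e * `|w| ^+ 2 <= dot (w *m D) (w *m D).
  apply: le_trans (norm_sqr_le_dot _).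
  apply: le_trans (_ : (c ^+ 2)^-1 * `|w| ^+ 2 <= _); last first.
    rewrite ler_pdivrMl ?exprn_gt0// -exprMn ler_sqr ?nnegrE//.
    by rewrite mulr_ge0// ltW.
  rewrite ler_wpM2r ?sqr_ge0//.
  apply: le_trans (_ : (M + 1) * ((M + 1) * c ^+ 2)^-1 <= _); last first.
    rewrite invfM mulrA divff ?mul1r// gt_eqF// ltr_wpDl//.
  by rewrite ler_pM// ?lerDl// ge_min lexx orbT.
have E4 : dot (w *m D) (w *m D) <= beta * dot (w *m D) (w *m D).
  by rewrite ler_peMl// dot_ge0.
have := Apos (w *m D).
rewrite ident; move: E1 E2 E3; rewrite !ler_norml /M; lra.
Qed.

(** If the form were positive on the difference of two points whose orbits stay in the ball, it
    would grow geometrically along the differences of their iterates, which are bounded. So all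
    differences lie in the cone of [quad_cone_bound], and the projection onto a hyperplane is
    expanding on the set. *)
Lemma null_never_escape (T : 'rV[R]_d -> 'rV[R]_d) x A v :
  strictly_diff T x A -> A^T = A -> (forall w, 0 <= dot (w *m A) w) ->
  dot v v < dot (v *m A) v ->
  exists2 r : R, 0 < r & lebesgue_null
    [set y | forall k, `|iter k T y - x| < r].
Proof.
move=> dT Asym Apos vA; have v0 : 0 < dot v v.
  rewrite lt_neqAle dot_ge0 andbT eq_sym; apply/eqP => v0.
  by move: vA; rewrite (dot_eq0 v0) mul0mx dot0l ltxx.
have [beta /andP[beta1 betav] Dfree] : exists2 beta : R,
    1 < beta < dot (v *m A) v / dot v v & row_free (A - beta%:M).
  by apply: exists_non_eigenvalue; rewrite ltr_pdivlMr// mul1r.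
have [e e0 expand] := cone_expansion Asym Apos (ltW beta1) Dfree.
set D := A - beta%:M in Dfree expand.
have Dsym : D^T = D by rewrite /D linearB/= Asym tr_scalar_mx.
have [r r0 Tr] := dT e e0; exists r => //.
have vD : 0 < dot (v *m D) v.
  by rewrite /D mulmxBr mul_mx_scalar dotBl dotZl subr_gt0 -ltr_pdivlMr.
have [i vi] : exists i, v 0 i != 0.
  apply/existsP; rewrite -negb_forall; apply/negP => /forallP v0'.
  move: v0; rewrite (_ : v = 0) ?dot0l ?ltxx//.
  by apply/rowP => j; rewrite mxE; apply/eqP; rewrite -[_ == _]negbK v0'.
have [c c0 cP] := quad_cone_bound Dsym vD vi.
apply: (@null_expanding _ _ _ _ (fun y => y - (y 0 i / v 0 i) *: v) c c0); last
  exact: (null_hyperplane i).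
- move=> y z /= yr zr.
  rewrite (_ : _ - _ - (_ - _) = (y - z) - ((y - z) 0 i / v 0 i) *: v);
    last first.
    by apply/rowP => j; rewrite !mxE; ring.
  apply: cP; rewrite leNgt; apply/negP => Q0.
  pose w k := iter k T y - iter k T z.
  (* Each step multiplies the form by at least $\beta^2$; one factor [beta] suffices and the other
     is given up, the form being nonnegative here. *)
  have Qw k : beta ^+ k * dot ((y - z) *m D) (y - z) <= dot (w k *m D) (w k).
    elim: k => [|k IH]; first by rewrite expr0 mul1r.
    have := expand (w k) (w k.+1) (Tr _ _ (yr k) (zr k)); apply: le_trans.
    have b0 : 0 < beta by exact: lt_trans beta1.
    rewrite exprS -mulrA expr2 -mulrA ler_wpM2l ?(ltW b0)//.
    apply: (le_trans IH); rewrite ler_peMl ?(ltW beta1)//.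
    by apply: le_trans IH; rewrite mulr_ge0 ?exprn_ge0 ?ltW.
  have wr k : `|w k| <= 2 * r.
    rewrite /w (_ : _ - _ = (iter k T y - x) - (iter k T z - x)); last first.
      by rewrite opprB addrA subrK.
    rewrite (le_trans (ler_normB _ _))//; have := yr k; have := zr k; lra.
  have [k] := bernoulli_unbounded
    (d.+1%:R * (d.+1%:R * `|D| * (2 * r)) * (2 * r) /
    dot ((y - z) *m D) (y - z)) beta1.
  rewrite ltr_pdivrMr//; apply/negP; rewrite -leNgt (le_trans (Qw k))//.
  rewrite (le_trans (ler_norm _))// (le_trans (dot_norm_le _ _))//.
  rewrite ler_pM ?mulr_ge0 ?normr_ge0 ?wr// ler_wpM2l//.
  by rewrite (le_trans (mulmx_norm_le _ _))// ler_wpM2l ?wr// mulr_ge0.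
- by move=> y _ /=; rewrite !mxE divfK// subrr.
Qed.

End Escape.

(** * Strict differentiability of the proximal map *)

Lemma common_radius (R : realType) m (P : 'I_m -> R -> Prop) :
  (forall j, exists2 r : R, 0 < r & forall s, 0 < s -> s <= r -> P j s) ->
  exists2 r : R, 0 < r & forall j, P j r.
Proof.
move=> HP; have : \forall t \near 0^'+, forall j, P j t.
  apply: filter_forall => j; have [r r0 rP] := HP j.
  near=> t; apply: rP; first by near: t; exact: nbhs_right_gt.
  by near: t; exact: nbhs_right_le.
move=> near_t; near (0 : R)^'+ => t; exists t; near: t => //.
exact: nbhs_right_gt.
Unshelve. all: by end_near. Qed.

Lemma near_right_mul_lt (R : realType) (K b : R) : 0 <= K -> 0 < b ->
  \forall r \near 0^'+, K * r < b.
Proof.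
move=> K0 b0; have K10 : 0 < K + 1 by rewrite ltr_wpDl.
near=> r.
have r0 : 0 < r by near: r; exact: nbhs_right_gt.
apply: le_lt_trans (_ : (K + 1) * r < _); first by rewrite ler_wpM2r ?lerDl//
  ltW.
by rewrite -ltr_pdivlMl// mulrC; near: r; apply: nbhs_right_lt;
  rewrite divr_gt0.
Unshelve. all: by end_near. Qed.

Lemma norm_row_mx_le (R : realType) n m (u : 'rV[R]_n) (v : 'rV[R]_m) (e : R) :
  `|u| <= e -> `|v| <= e -> `|row_mx u v| <= e.
Proof.
move=> ue ve; have e0 : 0 <= e by exact: le_trans ue.
apply/rV_norm_leP => // i; rewrite mxE; case: splitP => k _.
  exact: le_trans (rV_norm_coord _ _) ue.
exact: le_trans (rV_norm_coord _ _) ve.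
Qed.

Lemma monotone_lipschitz (R : realType) d (P : 'rV[R]_d -> 'rV[R]_d) (kappa : R)
  :
  0 < kappa ->
  (forall x y, kappa * dot (P x - P y) (P x - P y) <= dot (P x - P y) (x - y))
    ->
  forall x y, `|P x - P y| <= d.+1%:R / kappa * `|x - y|.
Proof.
move=> kappa_gt0 P_mono x y.
have [->|z0] := eqVneq (P x - P y) 0.
  by rewrite normr0 mulr_ge0// divr_ge0// ltW.
have zp : 0 < `|P x - P y| by rewrite normr_gt0.
have h1 := ler_wpM2l (ltW kappa_gt0) (norm_sqr_le_dot (P x - P y)).
have h2 := le_trans (ler_norm _) (dot_norm_le (P x - P y) (x - y)).
have {h1 h2} h := le_trans h1 (le_trans (P_mono x y) h2).
by rewrite mulrAC ler_pdivlMr// -(ler_pM2r zp); move: h; rewrite expr2; lra.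
Qed.

Section KKT.
Context {R : realType} {d m : nat}.
Implicit Types (x y p q v w : 'rV[R]_d) (l : 'rV[R]_m).

Lemma C2_at_family (G_ : 'I_m -> 'rV[R]_d -> R)
  (g_ : 'I_m -> 'rV[R]_d -> 'rV[R]_d) x
    (K_ : 'I_m -> 'M[R]_d) : (forall j, C2_at (G_ j) (g_ j) x (K_ j)) ->
  exists r C : R, [/\ 0 < r, 0 <= C, forall j, has_grad (G_ j) (g_ j) x r &
    forall j p q, `|p - x| < r -> `|q - x| < r -> `|g_ j p - g_ j q| <=
      C * `|p - q|].
Proof.
move=> C2; have /choice[C_ HC] : forall j, exists C : R, 0 <=
  C /\ exists2 r : R, 0 < r &
    has_grad (G_ j) (g_ j) x r /\
    forall p q, `|p - x| < r -> `|q - x| < r -> `|g_ j p - g_ j q| <=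
      C * `|p - q|.
  move=> j; have [[r r0 hg] /strictly_diff_lip[s [C [s0 C0 gC]]]] := C2 j.
  exists C; split; [exact: ltW|exists (Num.min r s); first by rewrite lt_min
    r0].
  split=> [y|p q]; first by rewrite lt_min => /andP[yr _]; exact: hg.
  by rewrite !lt_min => /andP[_ ps] /andP[_ qs]; exact: gC.
have [r r0 Hr] : exists2 r : R, 0 < r & forall j, has_grad (G_ j) (g_ j) x r /\
    forall p q, `|p - x| < r -> `|q - x| < r -> `|g_ j p - g_ j q| <=
      C_ j * `|p - q|.
  apply: common_radius => j; have [_ [r r0 [hg gC]]] := HC j.
  exists r => // s s0 sr; split=> [y ys|p q ps qs].
    by apply: hg; exact: lt_le_trans sr.
  by apply: gC; exact: lt_le_trans sr.
have C0 j : 0 <= C_ j by have [] := HC j.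
exists r, (\sum_j C_ j); split => //; first by apply: sumr_ge0 => j _.
  by move=> j; have [] := Hr j.
move=> j p q pr qr; have [_ /(_ p q pr qr) h] := Hr j; apply: (le_trans h).
by rewrite ler_wpM2r// (bigD1 j)//= lerDl sumr_ge0.
Qed.

Lemma independent_lower_bound (u : 'I_m -> 'rV[R]_d) :
  (forall l, \sum_j l 0 j *: u j = 0 -> l = 0) ->
  exists2 a : R, 0 < a & forall l, `|l| <= a * `|\sum_j l 0 j *: u j|.
Proof.
move=> /independent_right_inverse[B uB].
exists (d.+1%:R * `|B| + 1); first by rewrite ltr_wpDl// mulr_ge0.
move=> l; rewrite -{1}(uB l) (le_trans (mulmx_norm_le _ _))//.
by rewrite ler_wpM2r// lerDl.
Qed.

(** A small perturbation of independent vectors at most doubles the constant of the lower bound: the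
    perturbation term is absorbed in the left side. *)
Lemma norm_le_scaled_sum_near (u v : 'I_m -> 'rV[R]_d) (a e : R) :
  (forall l, `|l| <= a * `|\sum_j l 0 j *: u j|) -> 0 <= a -> 0 <= e ->
  (forall j, `|v j - u j| <= e) -> a * (m%:R * e) <= 2^-1 ->
  forall l, `|l| <= 2 * a * `|\sum_j l 0 j *: v j|.
Proof.
move=> ua a0 e0 vu ae l; have := ua l.
have -> : \sum_j l 0 j *: u j =
  \sum_j l 0 j *: v j - \sum_j l 0 j *: (v j - u j).
  by rewrite -sumrB; apply: eq_bigr => j _; rewrite -scalerBr opprB addrC subrK.
have h1 := norm_scaled_sum_le l e0 vu.
have h2 := ler_normB (\sum_j l 0 j *: v j) (\sum_j l 0 j *: (v j - u j)).
have h3 := ler_wpM2l a0 (le_trans h2 (lerD (lexx _) h1)).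
have h4 := ler_wpM2r (normr_ge0 l) ae.
lra.
Qed.

(** * Proximal steps under equality constraints near a fixed point *)

Variables (P : 'rV[R]_d -> 'rV[R]_d) (x0 : 'rV[R]_d) (mu kappa r0 : R).
Variables (L : 'rV[R]_d -> R) (gL : 'rV[R]_d -> 'rV[R]_d) (H : 'M[R]_d).
Variables (G_ : 'I_m -> 'rV[R]_d -> R) (g_ : 'I_m -> 'rV[R]_d -> 'rV[R]_d)
  (K_ : 'I_m -> 'M[R]_d).
Hypothesis mu_gt0 : 0 < mu.
Hypothesis kappa_gt0 : 0 < kappa.
Hypothesis r0_gt0 : 0 < r0.
Hypothesis P_mono : forall x y, kappa * dot (P x - P y) (P x - P y) <=
  dot (P x - P y) (x - y).
Hypothesis P_fix : P x0 = x0.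
Hypothesis L_C2 : C2_at L gL x0 H.
Hypothesis gL_x0 : gL x0 = 0.
Hypothesis G_C2 : forall j, C2_at (G_ j) (g_ j) x0 (K_ j).
Hypothesis g_free : forall l, \sum_j l 0 j *: g_ j x0 = 0 -> l = 0.
Hypothesis P_feasible : forall x, `|x - x0| < r0 -> forall j, G_ j (P x) = 0.
Hypothesis P_minimal : forall x y, `|x - x0| < r0 -> `|y - x0| < r0 ->
  (forall j, G_ j y = 0) ->
  L (P x) + (2 * mu)^-1 * dot (P x - x) (P x - x) <=
  L y + (2 * mu)^-1 * dot (y - x) (y - x).

Lemma P_lipschitz : exists2 c : R, 0 < c &
  (forall x y, `|P x - P y| <= c * `|x - y|) /\
  (forall x, `|P x - x0| <= c * `|x - x0|).
Proof.
have lip := monotone_lipschitz kappa_gt0 P_mono.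
exists (d.+1%:R / kappa); first by rewrite divr_gt0.
by split=> // x; rewrite -{1}P_fix.
Qed.

(** The multiplier rule is applied at [P x], where the constraint gradients are still independent
    with a uniform constant. The left side is Lipschitz along [P] and vanishes at [x0], because [L]
    is a Lagrangian with [gL x0 = 0]; hence the multipliers are of order $|x-x0|$. *)
Lemma multipliers : exists r C : R, [/\ 0 < r, 0 <= C &
  forall x, `|x - x0| < r -> exists2 l : 'rV[R]_m,
    gL (P x) + mu^-1 *: (P x - x) = \sum_j l 0 j *: g_ j (P x) &
    `|l| <= C * `|x - x0|].
Proof.
have [c c_gt0 [P_lip P_near]] := P_lipschitz.
have [r1 [C1 [r1_gt0 C1_ge0 hgj gjC]]] := C2_at_family G_C2.
have [[r2 r2_gt0 hg] /strictly_diff_lip[r3 [C3 [r3_gt0 C3_gt0 gC]]]] := L_C2.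
have [a a_gt0 abound] := independent_lower_bound g_free.
pose rb := Num.min r0 (Num.min r1 (Num.min r2 r3)).
have rb_gt0 : 0 < rb by rewrite !lt_min r0_gt0 r1_gt0 r2_gt0.
have rbE y : `|y - x0| < rb ->
  [/\ `|y - x0| < r0, `|y - x0| < r1, `|y - x0| < r2 & `|y - x0| < r3].
  by rewrite !lt_min => /and4P[].
(* The first bound keeps the ball of radius [rb / 2] around [P x] inside that of radius [rb] around
   [x0]; the second makes the gradients at [P x] close enough to those at [x0] for
   [norm_le_scaled_sum_near]. *)
pose s := Num.min (rb / 2) ((2 * ((a + 1) * ((m%:R + 1) * (C1 + 1))))^-1).
have s_gt0 : 0 < s.
  by rewrite lt_min divr_gt0//= invr_gt0 !mulr_gt0// ltr_wpDl// ltW.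
pose r := Num.min r0 (s / c).
exists r, (2 * a * (C3 * c + mu^-1 * (c + 1))); split.
- by rewrite lt_min r0_gt0 divr_gt0.
- by rewrite !mulr_ge0// ?addr_ge0// ?mulr_ge0// ?addr_ge0// ?invr_ge0 ltW.
move=> x; rewrite lt_min => /andP[xr0 xs].
have Ps : `|P x - x0| < s.
  by apply: le_lt_trans (P_near x) _; rewrite mulrC -ltr_pdivlMr.
have Prb : `|P x - x0| + rb / 2 <= rb.
  have : s <= rb / 2 by rewrite ge_min lexx.
  lra.
have inball y : `|y - P x| < rb / 2 -> `|y - x0| < rb.
  by move=> yr; rewrite -(subrK (P x) y) -addrA (le_lt_trans (ler_normD _ _))//;
    lra.
have Pinball : `|P x - x0| < rb by apply: inball; rewrite subrr normr0 divr_gt0.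
have lower := norm_le_scaled_sum_near abound (ltW a_gt0)
  (v := fun j => g_ j (P x)) (e := C1 * s).
have {}lower l : `|l| <= 2 * a * `|\sum_j l 0 j *: g_ j (P x)|.
  apply: lower.
  - by rewrite mulr_ge0// ltW.
  - move=> j; have [_ h1 _ _] := rbE _ Pinball.
    rewrite (le_trans (gjC _ _ _ h1 _)) ?subrr ?normr0//.
    by rewrite ler_wpM2l// ltW.
  - have : s * (2 * ((a + 1) * ((m%:R + 1) * (C1 + 1)))) <= 1.
      rewrite -ler_pdivlMr ?mul1r ?ge_min ?lexx ?orbT//.
      by rewrite !mulr_gt0// ltr_wpDl// ltW.
    have h : a * (m%:R * (C1 * s)) <= (a + 1) * ((m%:R + 1) * ((C1 + 1) * s)).
      have sC : C1 * s <= (C1 + 1) * s by rewrite ler_wpM2r ?lerDl// ltW.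
      have sC0 : 0 <= C1 * s by rewrite mulr_ge0// ltW.
      have h2 : m%:R * (C1 * s) <= (m%:R + 1) * ((C1 + 1) * s)
        by rewrite ler_pM// lerDl.
      by rewrite ler_pM ?lerDl ?(ltW a_gt0)// mulr_ge0.
    lra.
have [l lE] : exists l : 'rV[R]_m, gL (P x) + mu^-1 *: (P x - x) =
  \sum_j l 0 j *: g_ j (P x).
  apply: (@lagrange_multiplier _ _ _
    (fun y => L y + (2 * mu)^-1 * dot (y - x) (y - x))
    (fun y => gL y + mu^-1 *: (y - x)) G_ g_ (P x) (rb / 2) (C1 + C3 + mu^-1)).
  - by rewrite divr_gt0.
  - by rewrite !addr_ge0 ?invr_ge0// ltW.
  - move=> y /inball /rbE[_ _ h2 _] v; rewrite dotDl dotZl.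
    apply: is_deriveD; first exact: hg.
    have := is_deriveZ (2 * mu)^-1 (is_derive_dist x y v).
    move=> h; apply: (is_derive_eq h); rewrite /GRing.scale/=; field.
    by rewrite gt_eqF.
  - by move=> j y /inball /rbE[_ h1 _ _]; exact: hgj.
  - move=> y /inball /rbE[_ _ _ h3].
    have -> : gL y + mu^-1 *: (y - x) - (gL (P x) + mu^-1 *: (P x - x)) =
      (gL y - gL (P x)) + mu^-1 *: (y - P x).
      by apply/rowP => i; rewrite !mxE; ring.
    rewrite (le_trans (ler_normD _ _))//
      normrZ (gtr0_norm (_ : 0 < mu^-1)) ?invr_gt0//.
    rewrite !mulrDl lerD2r (le_trans (gC _ _ h3 _)) ?lerDr ?mulr_ge0//.
    by have [] := rbE _ Pinball.
  - move=> j y /inball /rbE[_ h1 _ _]; rewrite (le_trans (gjC _ _ _ h1 _))//.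
      by have [] := rbE _ Pinball.
    by rewrite ler_wpM2r// -addrA lerDl addr_ge0 ?invr_ge0// ltW.
  - exact: P_feasible.
  - by move=> y /inball /rbE[h0 _ _ _] Gy; exact: P_minimal.
  - move=> l l0; apply/eqP; rewrite -normr_le0.
    by have := lower l; rewrite l0 normr0 mulr0.
exists l => //; apply: (le_trans (lower l)); rewrite -lE.
rewrite -(mulrA (2 * a)) ler_wpM2l ?mulr_ge0// ?(ltW a_gt0)//
  (le_trans (ler_normD _ _))//.
rewrite mulrDl lerD//.
  have [_ _ _ h3] := rbE _ Pinball.
  have := gC _ x0 h3; rewrite subrr normr0 gL_x0 subr0 => /(_ r3_gt0) h.
  by rewrite (le_trans h)// -mulrA ler_wpM2l ?(ltW C3_gt0)// P_near.
rewrite normrZ gtr0_norm ?invr_gt0// -mulrA ler_wpM2l ?invr_ge0 ?(ltW mu_gt0)//.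
rewrite (_ : P x - x = (P x - x0) - (x - x0)); last by rewrite opprB addrA
  subrK.
by rewrite (le_trans (ler_normB _ _))// mulrDl mul1r lerD2r P_near.
Qed.


Let N : 'M[R]_(d, m) := \matrix_(i, j) g_ j x0 0 i.
(** The KKT matrix: [row_mx z l *m KK = row_mx w 0] means $z+\mu zH+lN^T=w$ and $zN=0$, the
    linearized optimality and feasibility conditions. *)
Let KK : 'M[R]_(d + m) := block_mx (1%:M + mu *: H) N N^T 0.

Let mulNT l : l *m N^T = \sum_j l 0 j *: g_ j x0.
Proof.
rewrite mulmx_sum_row; apply: eq_bigr => j _; congr (_ *: _).
by apply/rowP => i; rewrite !mxE.
Qed.

Let mulN v j : (v *m N) 0 j = dot (g_ j x0) v.
Proof. by rewrite mxE; apply: eq_bigr => i _; rewrite mxE mulrC. Qed.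

(** Subtract the optimality conditions at [x] and [y]. The gradient of [L] is linearized by strict
    differentiability. Replacing constraint gradients by those at [x0] costs little, since the
    multipliers are small and their difference is of order $|x-y|$. The second block is small
    because the constraints vanish at both images. *)
Lemma two_point (e : R) : 0 < e -> exists2 r : R, 0 < r &
  forall x y, `|x - x0| < r -> `|y - x0| < r ->
    exists l, `|row_mx (P x - P y) l *m KK - row_mx (x - y) 0| <= e * `|x - y|.
Proof.
move=> e0; have [c c_gt0 [P_lip P_near]] := P_lipschitz.
have [r1 [C1 [r1_gt0 C1_ge0 _ gjC]]] := C2_at_family G_C2.
have [r2 [C2 [r2_gt0 C2_ge0 mult]]] := multipliers.
have /strictly_diff_lip[r3 [C3 [r3_gt0 C3_gt0 gC]]] := L_C2.2.
have [a a_gt0 abound] := independent_lower_bound g_free.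
have e1_gt0 : 0 < e / (2 * (mu * c)) by rewrite divr_gt0// !mulr_gt0.
have [r4 r4_gt0 Hr4] := L_C2.2 _ e1_gt0.
have ec_gt0 : 0 < e / c by rewrite divr_gt0.
have [r5 r5_gt0 Hr5] : exists2 r : R, 0 < r & forall j p q, `|p - x0| < r ->
  `|q - x0| < r ->
    `|G_ j p - G_ j q - dot (g_ j x0) (p - q)| <= e / c * `|p - q|.
  apply: common_radius => j; have [r rp rG] := C2_at_strict (G_C2 j) ec_gt0.
  exists r => // s s0 sr p q ps qs; apply: rG; exact: lt_le_trans sr.
pose c5 := 2 * a * (C3 * c + mu^-1 * (c + 1) + m%:R * (C1 * c) * C2).
have c5_ge0 : 0 <= c5.
  by rewrite !mulr_ge0 ?addr_ge0 ?mulr_ge0 ?addr_ge0 ?invr_ge0// ltW.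
near (0 : R)^'+ => r.
have r_gt0 : 0 < r by near: r; exact: nbhs_right_gt.
have rr0 : r < r0 by near: r; exact: nbhs_right_lt.
have rr2 : r < r2 by near: r; exact: nbhs_right_lt.
have r_lt1 : r < 1 by near: r; exact: nbhs_right_lt.
have cr1 : c * r < r1 by near: r; apply: near_right_mul_lt => //; exact: ltW.
have cr3 : c * r < r3 by near: r; apply: near_right_mul_lt => //; exact: ltW.
have cr4 : c * r < r4 by near: r; apply: near_right_mul_lt => //; exact: ltW.
have cr5 : c * r < r5 by near: r; apply: near_right_mul_lt => //; exact: ltW.
have ar : a * (m%:R * (C1 * c)) * r < 2^-1.
  by near: r; apply: near_right_mul_lt; rewrite ?invr_gt0// !mulr_ge0// ltW.
have er : mu * (m%:R * (C1 * c) * (c5 + C2)) * r < e / 2.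
  near: r; apply: near_right_mul_lt; last by rewrite divr_gt0.
  by rewrite !mulr_ge0// ?addr_ge0// ltW.
exists r => // x y xr yr.
have [lx lxE _] := mult x (lt_trans xr rr2).
have [ly lyE ly_le] := mult y (lt_trans yr rr2).
pose p := P x; pose q := P y; pose s := `|x - y|.
have zs : `|p - q| <= c * s by exact: P_lip.
have pr : `|p - x0| < c * r by rewrite (le_lt_trans (P_near x))// ltr_pM2l.
have qr : `|q - x0| < c * r by rewrite (le_lt_trans (P_near y))// ltr_pM2l.
have cr_gt0 : 0 < c * r by rewrite mulr_gt0.
have s0 : 0 <= s by exact: normr_ge0.
(* The optimality condition is multiplied by [mu], with the multipliers moved to the other side. *)
exists (- mu *: (lx - ly)).
rewrite mul_row_block mulmx0 addr0 mulmxDr mulmx1 -scalemxAr opp_row_mx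
  add_row_mx oppr0 addr0.
(* [S3] is given exactly by the difference of the optimality conditions, up to [S2], the change of
   constraint gradients between [p] and [q]. [S1] is the cost of moving these gradients to [x0].
   Both [S1] and [S2] are of order $r|x-y|$. *)
pose S1 := \sum_j (lx - ly) 0 j *: (g_ j p - g_ j x0).
pose S2 := \sum_j ly 0 j *: (g_ j p - g_ j q).
pose S3 := \sum_j (lx - ly) 0 j *: g_ j p.
have S3E : S3 = gL p - gL q + mu^-1 *: ((p - q) - (x - y)) - S2.
  have -> : gL p - gL q + mu^-1 *: ((p - q) - (x - y)) =
      (gL p + mu^-1 *: (p - x)) - (gL q + mu^-1 *: (q - y)).
    by apply/rowP => i; rewrite !mxE; ring.
  rewrite lxE lyE /S3 /S2 -!sumrB; apply: eq_bigr => j _.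
  by apply/rowP => i; rewrite !mxE; ring.
have S2_le : `|S2| <= m%:R * (C1 * c) * C2 * (r * s).
  apply: (le_trans (norm_scaled_sum_le (e := C1 * (c * s)) _ _ _)).
  - by rewrite !mulr_ge0// ltW.
  - move=> j; apply: (le_trans (gjC j p q (lt_trans pr cr1) (lt_trans qr cr1))).
    by rewrite ler_wpM2l.
  have h : `|ly| <= C2 * r by rewrite (le_trans ly_le)// ler_wpM2l// ltW.
  apply: le_trans (ler_wpM2l _ h) _; first by rewrite !mulr_ge0// ltW.
  by rewrite le_eqVlt; apply/orP; left; apply/eqP; ring.
have l_le : `|lx - ly| <= c5 * s.
  apply: le_trans (norm_le_scaled_sum_near abound (ltW a_gt0)
    (v := fun j => g_ j p) (e := C1 * (c * r)) _ _ _ (lx - ly)) _.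
  - by rewrite mulr_ge0// ltW.
  - move=> j; have := gjC j p x0 (lt_trans pr cr1); rewrite subrr normr0 =>
    /(_ r1_gt0) h.
    by rewrite (le_trans h)// ler_wpM2l// ltW.
  - by move: ar; lra.
  rewrite /c5 -[in leRHS]mulrA ler_wpM2l ?mulr_ge0 ?(ltW a_gt0)// -/S3 S3E.
  apply: (le_trans (ler_normB _ _)); rewrite mulrDl lerD//.
    apply: (le_trans (ler_normD _ _)); rewrite mulrDl lerD//.
      apply: le_trans (gC _ _ (lt_trans pr cr3) (lt_trans qr cr3)) _.
      by rewrite -mulrA ler_wpM2l// ltW.
    rewrite normrZ gtr0_norm ?invr_gt0//
      -mulrA ler_wpM2l ?invr_ge0 ?(ltW mu_gt0)//.
    by rewrite (le_trans (ler_normB _ _))// mulrDl mul1r lerD2r.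
  apply: (le_trans S2_le); rewrite ler_wpM2l ?mulr_ge0 ?(ltW c_gt0)//.
  by rewrite ler_piMl// ltW.
have S1_le : `|S1| <= m%:R * (C1 * c) * c5 * (r * s).
  apply: (le_trans (norm_scaled_sum_le (e := C1 * (c * r)) _ _ _)).
  - by rewrite !mulr_ge0// ltW.
  - move=> j; have := gjC j p x0 (lt_trans pr cr1); rewrite subrr normr0 =>
    /(_ r1_gt0) h.
    by rewrite (le_trans h)// ler_wpM2l// ltW.
  apply: le_trans (ler_wpM2l _ l_le) _; first by rewrite !mulr_ge0// ltW.
  by rewrite le_eqVlt; apply/orP; left; apply/eqP; ring.
apply: norm_row_mx_le.
  have -> : p - q + mu *: ((p - q) *m H) + - mu *: (lx - ly) *m N^T - (x - y) =
      mu *: (S1 + S2 - (gL p - gL q - (p - q) *m H)).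
    have -> : - mu *: (lx - ly) *m N^T = - mu *: (S3 - S1).
      rewrite -scalemxAl mulNT /S3 /S1 -sumrB; congr (_ *: _); apply: eq_bigr =>
        j _.
      by rewrite -scalerBr subKr.
    rewrite S3E; have alg (X Y Z U V D W : 'rV[R]_d) :
        D + mu *: Z + - mu *: (U - V + mu^-1 *: (D - W) - Y - X) - W =
        mu *: (X + Y - (U - V - Z)).
      by apply/rowP => i; rewrite !mxE; field; rewrite gt_eqF.
    exact: alg.
  rewrite normrZ gtr0_norm//.
  have h1 := Hr4 _ _ (lt_trans pr cr4) (lt_trans qr cr4).
  have h2 : e / (2 * (mu * c)) * `|p - q| <= e / (2 * mu) * s.
    apply: le_trans (ler_wpM2l (ltW e1_gt0) zs) _.
    by rewrite le_eqVlt; apply/orP; left; apply/eqP; field; rewrite !gt_eqF.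
  have h3 : `|S1 + S2 - (gL p - gL q - (p - q) *m H)| <=
      m%:R * (C1 * c) * c5 * (r * s) + m%:R * (C1 * c) * C2 * (r * s) + e /
        (2 * mu) * s.
    apply: (le_trans (ler_normB _ _)); apply: lerD; last exact: le_trans h2.
    by apply: (le_trans (ler_normD _ _)); apply: lerD.
  apply: le_trans (ler_wpM2l (ltW mu_gt0) h3) _.
  have h4 := ler_wpM2r s0 (ltW er).
  have h5 : mu * (e / (2 * mu) * s) = e / 2 * s by field; rewrite gt_eqF.
  rewrite !mulrDr h5 -/s; move: h4; rewrite mulrDr; lra.
apply/rV_norm_leP => [|j]; first by rewrite mulr_ge0// ltW.
rewrite mulN; have := Hr5 j p q (lt_trans pr cr5) (lt_trans qr cr5).
rewrite (P_feasible (lt_trans xr rr0)) (P_feasible (lt_trans yr rr0)) subrr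
  sub0r normrN.
move=> /le_trans; apply; apply: le_trans (ler_wpM2l (ltW ec_gt0) zs) _.
by rewrite mulrA divfK// gt_eqF.
Unshelve. all: by end_near. Qed.


Let KKsym : KK^T = KK.
Proof.
by rewrite tr_block_mx trmxK trmx0 linearD linearZ/= trmx1 (C2_at_sym L_C2).
Qed.

(* If (u, b) KK = 0, then pairing (u, b) with the perturbed system solved at
   x0 + t u leaves t <u, u> = o(t). *)
Let KK_unit : KK \in unitmx.
Proof.
rewrite -row_free_unit -kermx_eq0; apply/eqP/row_matrixP => i; rewrite row0.
have : row i (kermx KK) *m KK = 0 by rewrite -row_mul mulmx_ker row0.
move: (row i (kermx KK)) => k; rewrite -(hsubmxK k).
move: (lsubmx k) (rsubmx k) => u b ub0.
have {}k0 : u = 0.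
  apply: dot_eq0; apply/eqP; rewrite eq_le dot_ge0 andbT; apply/ler_addgt0Pr =>
    e e0.
  pose D := (d + m).+1%:R * `|u| * `|row_mx u b| : R.
  have D0 : 0 < D + 1 by rewrite ltr_wpDl// !mulr_ge0.
  have [r r_gt0 Hr] := two_point (divr_gt0 e0 D0).
  pose t := r / (2 * (`|u| + 1)).
  have u1 : 0 < `|u| + 1 by rewrite ltr_wpDl.
  have t0 : 0 < t by rewrite divr_gt0// mulr_gt0.
  have tu : `|x0 + t *: u - x0| < r.
    rewrite addrC addKr normrZ gtr0_norm// /t mulrAC ltr_pdivrMr ?mulr_gt0//
      ltr_pM2l//.
    by have := normr_ge0 u; lra.
  have [|l] := Hr (x0 + t *: u) x0 tu; first by rewrite subrr normr0.
  have -> : x0 + t *: u - x0 = t *: u by rewrite addrC addKr.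
  set z := P _ - P _; set err := _ - _ => err_le.
  have E : dot err (row_mx u b) = - (t * dot u u).
    rewrite /err dotBl -{1}KKsym -dot_mulmxr ub0 dot0r sub0r; congr (- _).
    by rewrite dotE tr_row_mx mul_row_col mul0mx addr0 -dotE dotZl.
  have := dot_norm_le err (row_mx u b); rewrite E normrN ger0_norm; last first.
    by rewrite mulr_ge0 ?dot_ge0// ltW.
  move=> /le_trans/(_ (ler_wpM2r (normr_ge0 _) (ler_wpM2l (ler0n _ _) err_le))).
  rewrite normrZ gtr0_norm// add0r => h; rewrite -(ler_pM2l t0);
    apply: (le_trans h).
  have -> : (d + m).+1%:R * (e / (D + 1) * (t * `|u|)) * `|row_mx u b| =
      t * (e * (D / (D + 1))).
    by rewrite /D; field; rewrite gt_eqF.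
  rewrite ler_pM2l// ler_piMr ?(ltW e0)// ler_pdivrMr// mul1r lerDl//.
rewrite k0 in ub0 *; move: ub0; rewrite mul_row_block mulmx0 addr0 mul0mx add0r.
move=> /(congr1 lsubmx); rewrite row_mxKl linear0 => bN.
by rewrite (g_free (l := b)) ?row_mx0// -mulNT.
Qed.

Let Kinv := invmx KK.
(** The block of the inverse that maps [x - y] to the linearized [P x - P y]; the multiplier part is
    dropped. *)
Let B : 'M[R]_d := ulsubmx Kinv.

Let lsubmx_Kinv (w : 'rV[R]_d) : lsubmx (row_mx w 0 *m Kinv) = w *m B.
Proof.
by rewrite -(submxK Kinv) mul_row_block !mul0mx !addr0 row_mxKl.
Qed.

Let norm_lsubmx (k : 'rV[R]_(d + m)) : `|lsubmx k| <= `|k|.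
Proof. by apply/rV_norm_leP => // i; rewrite mxE rV_norm_coord. Qed.

(** Multiplying the two-point estimate by the inverse KKT matrix gives the derivative. Its
    positivity is the limit of the monotonicity of [P]. For [u] orthogonal to the constraint
    gradients, [row_mx u 0 *m KK] has second block 0, which yields the last identity. *)
Lemma P_strictly_diff : exists B0 : 'M[R]_d,
  [/\ strictly_diff P x0 B0, B0^T = B0,
  forall w, 0 <= dot (w *m B0) w &
  forall u, (forall j, dot (g_ j x0) u = 0) -> (u + mu *: (u *m H)) *m B0 = u].
Proof.
have dB : strictly_diff P x0 B.
  move=> e e0; pose D := (d + m).+1%:R * `|Kinv| : R.
  have D0 : 0 < D + 1 by rewrite ltr_wpDl// mulr_ge0.
  have [r r_gt0 Hr] := two_point (divr_gt0 e0 D0); exists r => // x y xr yr.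
  have [l] := Hr x y xr yr; set err := _ - _ => err_le.
  have -> : P x - P y - (x - y) *m B = lsubmx (err *m Kinv).
    by rewrite [err *m _]mulmxBl mulmxK// linearB/= row_mxKl lsubmx_Kinv.
  apply: (le_trans (norm_lsubmx _)); apply: (le_trans (mulmx_norm_le _ _)).
  apply: le_trans (ler_wpM2l _ err_le) _; first by rewrite mulr_ge0.
  rewrite mulrA ler_wpM2r// -/D mulrCA ler_piMr ?(ltW e0)//.
  by rewrite ler_pdivrMr// mul1r lerDl.
exists B; split => //.
- by rewrite /B trmx_ulsub /Kinv trmx_inv KKsym.
- move=> w; rewrite -oppr_le0; apply/ler_addgt0Pr => e e0; rewrite add0r.
  pose D := d.+1%:R * `|w| ^+ 2 : R.
  have D0 : 0 < D + 1 by rewrite ltr_wpDl// mulr_ge0 ?sqr_ge0.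
  have [r r_gt0 Hr] := dB _ (divr_gt0 e0 D0).
  pose t := r / (2 * (`|w| + 1)).
  have w1 : 0 < `|w| + 1 by rewrite ltr_wpDl.
  have t0 : 0 < t by rewrite divr_gt0// mulr_gt0.
  have tw : `|x0 + t *: w - x0| < r.
    rewrite addrC addKr normrZ gtr0_norm// /t mulrAC ltr_pdivrMr ?mulr_gt0//
      ltr_pM2l//.
    by have := normr_ge0 w; lra.
  have := Hr (x0 + t *: w) x0 tw; rewrite subrr normr0 => /(_ r_gt0).
  have := P_mono (x0 + t *: w) x0.
  have -> : x0 + t *: w - x0 = t *: w by rewrite addrC addKr.
  set z := P _ - P _ => mono; set err := _ - _ => err_le.
  have zE : z = err + t *: (w *m B) by rewrite /err -scalemxAl subrK.
  have zw : 0 <= dot z (t *: w).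
    by apply: le_trans mono; rewrite mulr_ge0 ?dot_ge0// ltW.
  have := dot_norm_le err (t *: w).
  move=> /le_trans/(_ (ler_wpM2r (normr_ge0 _) (ler_wpM2l (ler0n _ _) err_le))).
  rewrite normrZ gtr0_norm//.
  have -> : d.+1%:R * (e / (D + 1) * (t * `|w|)) * (t * `|w|) =
    t ^+ 2 * (e * (D / (D + 1))).
    by rewrite /D; field; rewrite gt_eqF.
  move: zw; rewrite {1}zE dotDl dotZl (dotZr t w (w *m B)) => zw.
  rewrite ler_norml => /andP[_ h].
  have De : e * (D / (D + 1)) <= e.
    by rewrite ler_piMr ?(ltW e0)// ler_pdivrMr// mul1r lerDl.
  have t20 : 0 < t ^+ 2 by rewrite exprn_gt0.
  rewrite -(ler_pM2l t20).
  have := ler_wpM2l (ltW t20) De; lra.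
- move=> u gu; rewrite -lsubmx_Kinv.
  have -> : row_mx (u + mu *: (u *m H)) 0 = row_mx u 0 *m KK.
    rewrite mul_row_block !mul0mx !addr0 mulmxDr mulmx1 -scalemxAr.
    by congr row_mx; apply/rowP => j; rewrite mulN gu mxE.
  by rewrite mulmxK// row_mxKl.
Qed.

End KKT.

(** * Active manifolds and strict saddles *)

Section Coordinates.
Context {R : realType} {d n : nat}.
Implicit Types (G : 'rV[R]_d -> 'rV[R]_n) (x v : 'rV[R]_d).

Lemma differentiable_coordinate G x j : differentiable G x ->
  differentiable ((fun y => G y 0 j) : _ -> R^o) x.
Proof.
move=> dG; apply: (@differentiable_comp _ _ _ _ G
  (fun M : 'rV[R]_n => M 0 j : R^o)) => //.
exact: differentiable_coord.
Qed.

Lemma derive_coordinate G x v j : differentiable G x ->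
  'D_v ((fun y => G y 0 j) : _ -> R^o) x = 'D_v G x 0 j.
Proof.
move=> dG; rewrite derive_mx; first by rewrite mxE.
exact: diff_derivable.
Qed.

Lemma Cp_on_coordinate p G j : Cp_on p setT G ->
  Cp_on p setT ((fun y => G y 0 j) : _ -> R^o).
Proof.
elim: p G => [|p IH] G /=.
  move=> Gc x _; apply: (@continuous_comp _ _ _ G
    (fun M : 'rV[R]_n => M 0 j : R^o)).
    exact: Gc.
  exact: coord_continuous.
move=> [dG ddG]; split=> [x _|v]; first exact/differentiable_coordinate/dG.
rewrite (_ : 'D_v _ = fun y => 'D_v G y 0 j); first exact: IH.
by apply/funext => y; rewrite derive_coordinate//; exact: dG.
Qed.

Lemma strictly_diff_id x : strictly_diff (fun y => y) x (1%:M : 'M[R]_d).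
Proof.
by move=> e e0; exists 1 => // p q _ _; rewrite mulmx1 subrr normr0 mulr_ge0//
  ltW.
Qed.

Lemma enorm_le_norm x : enorm x <= d.+1%:R * `|x|.
Proof.
rewrite -ler_sqr ?nnegrE ?enorm_ge0 ?mulr_ge0// enorm_sqr.
rewrite (le_trans (dot_le_norm_sqr _))// exprMn ler_wpM2r ?sqr_ge0//.
by rewrite expr2 ler_peMr// ler1n.
Qed.

Lemma open_nbhs_ball x (U : set 'rV[R]_d) : open_nbhs x U ->
  exists2 r : R, 0 < r & forall y, `|y - x| < r -> U y.
Proof.
by move=> [oU Ux]; apply/(rV_nearP x U); exact: open_nbhs_nbhs.
Qed.

End Coordinates.

(** * From the parabolic subderivative to the Hessian of the Lagrangian *)

Section Parabolic.
Context {R : realType} {d : nat}.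
Implicit Types (x u w : 'rV[R]_d) (M : set 'rV[R]_d).

(** A lower limit below [b] forces quotients below [b] on every set of the filter, and off [M] the
    quotient is [+oo]; so the points found lie on [M]. *)
Lemma parabolic_subderivative_lt (f : 'rV[R]_d -> \bar R) M x u w (c b : R) :
  (forall y, f y != -oo%E) -> M x -> f x \is a fin_num ->
  parabolic_subderivative (restrict_to f M) x u w = c%:E -> c < b ->
  forall e : R, 0 < e -> exists (t : R) (w' : 'rV[R]_d),
    [/\ 0 < t < e, `|w' - w| < 1,
        M (x + t *: u + (t ^+ 2 / 2) *: w') &
        (f (x + t *: u + (t ^+ 2 / 2) *: w')%R < f x + (t ^+ 2 / 2 * b)%:E)%E].
Proof.
move=> fNy Mx fx_fin; rewrite /parabolic_subderivative; set h :=
  (X in limf_einf X _).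
rewrite limf_einfE => sup_c cb e e0.
pose V : set (R * 'rV[R]_d) :=
  [set tw | 0 < tw.1 < e] `&` [set tw | `|tw.2 - w| < 1].
have FV : filter_prod 0^'+ (nbhs w) V.
  exists ([set t : R | 0 < t < e], [set w' | `|w' - w| < 1]) => /=; last first.
    by move=> [t w'] /= [].
  split; last by apply/(rV_nearP w (fun w' => `|w' - w| < 1)); exists 1.
  near=> t; apply/andP; split; near: t; first exact: nbhs_right_gt.
  exact: nbhs_right_lt.
have : (ereal_inf (h @` V) < b%:E)%E.
  apply: le_lt_trans (_ : c%:E < b%:E)%E; last by rewrite lte_fin.
  by rewrite -sup_c; apply: ereal_sup_ubound; exists V.
move=> /ereal_inf_lt[_ [[t w'] [/= te w'w] <-] hb]; exists t, w'.
have t0 : 0 < t by case/andP: te.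
have s0 : 0 < t ^+ 2 / 2 by rewrite divr_gt0// exprn_gt0.
move: hb; rewrite /h /restrict_to /= (mem_set Mx) adde0.
set y := (x + _ + _)%R; case: ifPn => [/set_mem My|_]; last first.
  move: fx_fin (fNy y); case: (f x) => [a| |]// _; case: (f y) => [q| |]//= _;
  by rewrite mulr_infty sgrV gtr0_sg// mul1e ltNge leey.
rewrite adde0 => hb; split => //.
move: fx_fin (fNy y) hb; case: (f x) => [a| |]// _; case: (f y) => [q| |]//= _.
  by rewrite -EFinM !lte_fin ltr_pdivrMr// ltrBlDl (mulrC b).
by rewrite mulr_infty sgrV gtr0_sg// mul1e ltNge leey.
Unshelve. all: by end_near. Qed.

(** The points are [x + t *: v] with [v = u + (t / 2) *: w']. As the gradient vanishes at [x], the
    increment of [L] is $\frac{t^2}2\langle vH,v\rangle+o(t^2)$; since [w'] stays bounded, [v] tends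
    to [u]. *)
Lemma hessian_lt (L : 'rV[R]_d -> R) gL H x u w (b : R) :
  C2_at L gL x H -> gL x = 0 ->
  (forall e : R, 0 < e -> exists (t : R) (w' : 'rV[R]_d),
    [/\ 0 < t < e, `|w' - w| < 1 &
     L (x + t *: u + (t ^+ 2 / 2) *: w') < L x + t ^+ 2 / 2 * b]) ->
  dot (u *m H) u <= b.
Proof.
move=> L2 gx Ht; apply/ler_addgt0Pr => e e0.
have Hsym := C2_at_sym L2.
pose k := `|u| + `|w| + 1.
have k0 : 0 < k by rewrite ltr_wpDl// addr_ge0.
have e1 : 0 < e / (4 * k ^+ 2) by rewrite divr_gt0// mulr_gt0// exprn_gt0.
have [r r0 Hr] := C2_at_taylor L2 e1.
pose C := 2 * (d.+1%:R * `|u *m H| * (`|w| + 1)) + d.+1%:R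
  * (d.+1%:R * `|H| * (`|w| + 1)) * (`|w| + 1).
have C0 : 0 <= C by rewrite addr_ge0// !mulr_ge0// ?addr_ge0// !mulr_ge0//
  addr_ge0.
have s0 : 0 < Num.min 1 (Num.min (r / k) (e / (C + 1))).
  by rewrite !lt_min ltr01 !divr_gt0// ltr_wpDl.
have [t [w' [/andP[t0]]]] := Ht _ s0.
rewrite !lt_min => /and3P[t1 tr te] w'w Lt.
pose v := u + (t / 2) *: w'.
have w'1 : `|w'| <= `|w| + 1.
  by rewrite -(subrK w w') (le_trans (ler_normD _ _))// addrC lerD2l ltW.
have vk : `|v| <= k.
  rewrite (le_trans (ler_normD _ _))//
    /k -addrA lerD2l normrZ gtr0_norm ?divr_gt0//.
  apply: le_trans w'1; rewrite ler_piMl//; lra.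
have E : x + t *: u + (t ^+ 2 / 2) *: w' = x + t *: v.
  by apply/rowP => i; rewrite !mxE; field.
have tv : `|t *: v| < r.
  rewrite normrZ gtr0_norm// (le_lt_trans (ler_wpM2l (ltW t0) vk))//.
  by rewrite -ltr_pdivlMr.
have := Hr _ tv; rewrite gx dot0l subr0 -E.
rewrite normrZ (gtr0_norm t0) exprMn -scalemxAl dotZl dotZr.
have vv : e / (4 * k ^+ 2) * (t ^+ 2 * `|v| ^+ 2) <= e / 4 * t ^+ 2.
  have v2 : `|v| ^+ 2 <= k ^+ 2 by rewrite ler_sqr ?nnegrE// ltW.
  have := ler_wpM2l (mulr_ge0 (ltW e1) (sqr_ge0 t)) v2.
  have -> : e / (4 * k ^+ 2) * t ^+ 2 * k ^+ 2 = e / 4 * t ^+ 2.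
    by field; rewrite gt_eqF.
  lra.
move=> /le_trans/(_ vv); rewrite ler_norml => /andP[h1 _].
have t20 : 0 < t ^+ 2 by rewrite exprn_gt0.
have h2 : dot (v *m H) v < b + e / 2.
  rewrite -(ltr_pM2l t20); move: h1 Lt; lra.
have h3 : dot (v *m H) v = dot (u *m H) u + t * dot (u *m H) w' + (t / 2) ^+ 2
  * dot (w' *m H) w'.
  rewrite /v quad_expand//; have -> : dot (w' *m H) u = dot (u *m H) w'.
    by rewrite dotC dot_mulmxr Hsym.
  by field.
have h4 : `|dot (u *m H) w'| <= d.+1%:R * `|u *m H| * (`|w| + 1).
  by rewrite (le_trans (dot_norm_le _ _))// ler_wpM2l// mulr_ge0.
have h5 : `|dot (w' *m H) w'| <=
  d.+1%:R * (d.+1%:R * `|H| * (`|w| + 1)) * (`|w| + 1).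
  rewrite (le_trans (dot_norm_le _ _))// ler_pM ?mulr_ge0 ?normr_ge0//.
  rewrite ler_wpM2l// (le_trans (mulmx_norm_le _ _))// ler_wpM2l// mulr_ge0//.
have h6 : t * C <= e.
  have : t * (C + 1) < e by rewrite -ltr_pdivlMr// ltr_wpDl.
  lra.
have h7 : t ^+ 2 <= t by rewrite expr2 ler_piMl// ltW.
have h8 : `|t * dot (u *m H) w'| <= t * (d.+1%:R * `|u *m H| * (`|w| + 1)).
  by rewrite normrM gtr0_norm// ler_wpM2l// ltW.
have h9 : `|(t / 2) ^+ 2 * dot (w' *m H) w'| <=
    t / 4 * (d.+1%:R * (d.+1%:R * `|H| * (`|w| + 1)) * (`|w| + 1)).
  rewrite normrM (ger0_norm (sqr_ge0 _)) ler_pM ?sqr_ge0 ?normr_ge0//; lra.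
have hC : 0 <= t * (d.+1%:R * (d.+1%:R * `|H| * (`|w| + 1)) * (`|w| + 1)).
  by rewrite !mulr_ge0 ?addr_ge0// ?mulr_ge0 ?addr_ge0// ltW.
move: h2 h6 h8 h9; rewrite h3 !ler_norml /C; lra.
Qed.

End Parabolic.

Section StrictSaddle.
Context {R : realType} {d : nat} (f : 'rV[R]_d -> \bar R) (rho mu : R).
Hypothesis f_gtNy : forall x, f x != -oo%E.
Hypothesis f_proper : exists x, f x != +oo%E.
Hypothesis f_closed : closed_epigraph f.
Hypothesis f_wconvex : weakly_convex rho f.
Hypothesis mu_gt0 : 0 < mu.
Hypothesis rho_lt : rho < mu^-1.

Let P := prox mu f.
Let kappa := mu * (mu^-1 - rho) / 2.
Let kappa_gt0 : 0 < kappa.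
Proof. by rewrite /kappa divr_gt0// mulr_gt0// subr_gt0. Qed.
Let P_mono x y : kappa * dot (P x - P y) (P x - P y) <= dot (P x - P y) (x - y).
Proof. exact: prox_monotone. Qed.

Lemma sharp_gap (M U : set 'rV[R]_d) :
  (0 < ereal_inf [set (enorm v)%:E | v in \bigcup_(y in U `\` M) subdifferential
    f y])%E ->
  exists2 s : R, 0 < s & forall y v, U y -> subdifferential f y v ->
    enorm v < s -> M y.
Proof.
set i := ereal_inf _ => i0.
have [s s0 si] : exists2 s : R, 0 < s & (s%:E <= i)%E.
  (* An infimum [+oo] admits any threshold; 1 is taken. *)
  by case: i i0 => [a a0| _|//]; [exists a|exists 1; rewrite ?leey].
exists s => // y v Uy yv vs; apply: contrapT => My.
have : (i <= (enorm v)%:E)%E by apply: ereal_inf_lbound; exists v => //;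
  exists y.
by move=> /(le_trans si); rewrite lee_fin leNgt vs.
Qed.

(** The subgradient [mu^-1 *: (x - P x)] at [P x] tends to 0 as [x] tends to [x0], whereas sharpness
    keeps subgradients off [M] away from 0. *)
Lemma prox_in_manifold (M U : set 'rV[R]_d) x0 : P x0 = x0 -> open_nbhs x0 U ->
  (0 < ereal_inf [set (enorm v)%:E | v in \bigcup_(y in U `\` M) subdifferential
    f y])%E ->
  exists2 r : R, 0 < r & forall x, `|x - x0| < r -> M (P x).
Proof.
move=> Px0 /open_nbhs_ball[rU rU0 rUP] /sharp_gap[s s0 sP].
have [c c0 [_ Pnear]] := P_lipschitz kappa_gt0 P_mono Px0.
have K0 : 0 < d.+1%:R * (mu^-1 * (c + 1)) by rewrite !mulr_gt0 ?invr_gt0//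
  addr_gt0.
exists (Num.min (rU / c) (s / (d.+1%:R * (mu^-1 * (c + 1))))).
  by rewrite lt_min !divr_gt0.
move=> x; rewrite lt_min => /andP[xU xs]; apply: (sP _ (mu^-1 *: (x - P x))).
- by apply: rUP; rewrite (le_lt_trans (Pnear x))// mulrC -ltr_pdivlMr.
- exact: (prox_subdifferential f_gtNy f_proper f_closed f_wconvex mu_gt0
  rho_lt).
- apply: (le_lt_trans (enorm_le_norm _)).
  rewrite normrZ gtr0_norm ?invr_gt0//.
  have h : `|x - P x| <= (c + 1) * `|x - x0|.
    rewrite (_ : x - P x = (x - x0) - (P x - x0)); last by rewrite opprB addrA
      subrK.
    by rewrite (le_trans (ler_normB _ _))// mulrDl mul1r addrC lerD2r.
  apply: le_lt_trans (_ : d.+1%:R * (mu^-1 * (c + 1)) * `|x - x0| < _).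
    by rewrite -!mulrA ler_wpM2l// ler_wpM2l ?invr_ge0 ?(ltW mu_gt0)// mulrA.
  by rewrite mulrC -ltr_pdivlMr.
Qed.

Lemma local_equations_C2 r (M : set 'rV[R]_d) x0 U
  (G : 'rV[R]_d -> 'rV[R]_(d - r)) :
  local_equations 2 M x0 U G ->
  let g j y := \row_i 'D_(delta_mx 0 i) ((fun z => G z 0 j) : _ -> R^o) y in
  [/\ forall j, exists K, C2_at (fun y => G y 0 j) (g j) x0 K,
      forall l : 'rV[R]_(d - r), \sum_j l 0 j *: g j x0 = 0 -> l = 0 &
      forall u, 'd G x0 u = 0 -> forall j, dot (g j x0) u = 0].
Proof.
move=> [rd _ G2 rankG _] g.
have dG y : differentiable G y by case: G2 => + _; apply.
have C2 j : exists K, C2_at (fun y => G y 0 j) (g j) x0 K.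
  by apply: (@Cp_on_C2_at _ _ setT) => //;
    [exact: openT|exact: (Cp_on_coordinate (p := 2))].
have gE j u : dot (g j x0) u = ('d G x0 u) 0 j.
  have [K [[s s0 /(_ x0)]]] := C2 j; rewrite subrr normr0 => /(_ s0 u)[_ <-] _.
  by rewrite derive_coordinate// deriveE.
split => //.
  move=> l l0; have : row_free (jacobian G x0)^T by rewrite /row_free mxrank_tr
    rankG.
  move=> /row_free_inj; apply; rewrite mul0mx -l0 mulmx_sum_row.
  apply: eq_bigr => j _; congr (_ *: _); apply/rowP => i; rewrite !mxE.
  by rewrite derive_coordinate// deriveE.
by move=> u Gu j; rewrite gE Gu mxE.
Qed.

(** Near [x0] the map [P] minimizes the smooth representative [F], plus the proximal term, on the
    zero set of [G]. Replacing [F] by the Lagrangian [L] changes nothing on that set, and [L] has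
    zero gradient and negative curvature along [u] at [x0]. *)
Lemma strict_saddle_prox x0 : P x0 = x0 -> strict_saddle f x0 ->
  exists (B : 'M[R]_d) (u : 'rV[R]_d), [/\ strictly_diff P x0 B, B^T = B,
    forall w, 0 <= dot (w *m B) w & dot u u < dot (u *m B) u].
Proof.
move=> Px0 [[fx0 _] [M [[Mx0 [U [oU _ smooth sharp]]]
  [u [c [tan [w d2] c0]]]]]].
have [V [F [oV F2 fF]]] := smooth x0 (conj Mx0 oU.2).
(* The equations are those that witness the tangency of [u], so [u] is in the kernel of their
   differential. *)
have [r [U' [G [loc Gu]]]] := tan.
have [_ oU' _ _ MG] := loc.
pose m := (d - r)%N.
have /= [C2G free tanG] := local_equations_C2 loc.
pose G_ (j : 'I_m) y := G y 0 j.
pose g_ (j : 'I_m) y := \row_i 'D_(delta_mx 0 i) (G_ j : _ -> R^o) y.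
have /choice[K_ C2K] : forall j : 'I_m, exists K,
  C2_at (G_ j) (g_ j) x0 K by exact: C2G.
have [HF C2F] := Cp_on_C2_at oV.1 oV.2 F2.
set gF := (fun y => \row_i _) in C2F.
have [s1 s1_gt0 PM] := prox_in_manifold Px0 oU sharp.
have [sU sU_gt0 inU] := open_nbhs_ball oU.
have [sV sV_gt0 inV] := open_nbhs_ball oV.
have [sU' sU'_gt0 inU'] := open_nbhs_ball oU'.
have Gx0 : G x0 = 0.
  by have [] : [set y | U' y /\ G y = 0] x0 by rewrite -MG; split => //;
    exact: oU'.2.
have [s s_gt0 sP] : exists2 s : R, 0 < s & forall y, `|y - x0| < s ->
  [/\ U y, V y & U' y].
  exists (Num.min sU (Num.min sV sU')) =>
    [|y]; first by rewrite !lt_min sU_gt0 sV_gt0.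
  by rewrite !lt_min => /and3P[yU yV yU']; split;
    [exact: inU|exact: inV|exact: inU'].
have GM y : `|y - x0| < s -> (forall j, G_ j y = 0) -> M y /\ f y = (F y)%:E.
  move=> /sP[Uy Vy U'y] Gy.
  have My : (M `&` U') y by rewrite MG; split => //; apply/rowP => j;
    rewrite mxE; exact: Gy.
  by split; [exact: My.1|apply: fF => //; split => //; exact: My.1].
have MF y : `|y - x0| < s -> M y -> f y = (F y)%:E /\ (forall j, G_ j y = 0).
  move=> /sP[Uy Vy U'y] My; split; first exact: fF.
  have [_ Gy] : [set y | U' y /\ G y = 0] y by rewrite -MG.
  by move=> j; rewrite /G_ Gy mxE.
have G_x0 j : G_ j x0 = 0 by rewrite /G_ Gx0 mxE.
have x0s : `|x0 - x0| < s by rewrite subrr normr0.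
have Fx0 := (MF x0 x0s Mx0).1.
(* As a fixed point of [P], [x0] minimizes [F] plus the proximal term on the manifold, and the
   proximal term has zero gradient at [x0]. *)
have [l lE] : exists l : 'rV[R]_m, gF x0 = \sum_j l 0 j *: g_ j x0.
  have [r1 [C1 [r1_gt0 C1_ge0 hgj gjC]]] := C2_at_family C2K.
  have [[r2 r2_gt0 hg] /strictly_diff_lip[r3 [C3 [r3_gt0 C3_gt0 gC]]]] := C2F.
  pose rb := Num.min s (Num.min r1 (Num.min r2 r3)).
  have rb_gt0 : 0 < rb by rewrite lt_min s_gt0 !lt_min r1_gt0 r2_gt0.
  have rbE y : `|y - x0| < rb ->
    [/\ `|y - x0| < s, `|y - x0| < r1, `|y - x0| < r2 & `|y - x0| < r3].
    by rewrite !lt_min => /and4P[].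
  have [||||||||l] := @lagrange_multiplier _ _ m
    (fun y => F y + (2 * mu)^-1 * dot (y - x0) (y - x0))
    (fun y => gF y + mu^-1 *: (y - x0)) G_ g_ x0 rb (C1 + C3 + mu^-1) rb_gt0.
  - by rewrite !addr_ge0 ?invr_ge0// ltW.
  - move=> y /rbE[_ _ h2 _] v; rewrite dotDl dotZl.
    apply: is_deriveD; first exact: hg.
    have h := is_deriveZ (2 * mu)^-1 (is_derive_dist x0 y v).
    by apply: (is_derive_eq h); rewrite /GRing.scale/=; field; rewrite gt_eqF.
  - by move=> j y /rbE[_ h1 _ _]; exact: hgj.
  - move=> y /rbE[_ _ _ h3]; rewrite subrr scaler0 addr0 addrAC.
    rewrite (le_trans (ler_normD _ _))//
      normrZ (gtr0_norm (_ : 0 < mu^-1)) ?invr_gt0//.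
    by rewrite !mulrDl lerD2r (le_trans (gC _ _ h3 _)) ?subrr ?normr0//
      lerDr mulr_ge0.
  - move=> j y /rbE[_ h1 _ _]; rewrite (le_trans (gjC _ _ _ h1 _)) ?subrr
    ?normr0//.
    by rewrite ler_wpM2r// -addrA lerDl addr_ge0 ?invr_ge0// ltW.
  - exact: G_x0.
  - move=> y /rbE[ys _ _ _] Gy; have [_ fy] := GM y ys Gy.
    have := proxP f_gtNy f_proper f_closed f_wconvex rho_lt x0 y.
    by rewrite -/P Px0 /prox_objective fy Fx0 !enorm_sqr -!EFinD lee_fin.
  - exact: free.
  by rewrite subrr scaler0 addr0 => E; exists l.
pose L y := F y + \sum_j (- l 0 j) * G_ j y.
pose gL y := gF y + \sum_j (- l 0 j) *: g_ j y.
pose H := HF + \sum_j (- l 0 j) *: K_ j.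
have C2L : C2_at L gL x0 H by apply: C2_atD => //; exact: C2_at_sum.
have gL0 : gL x0 = 0.
  by rewrite /gL lE -big_split/= big1// => j _; rewrite scaleNr subrr.
have LF y : (forall j, G_ j y = 0) -> L y = F y.
  by move=> Gy; rewrite /L big1 ?addr0// => j _; rewrite Gy mulr0.
have Hu : dot (u *m H) u < 0.
  (* The bound [c / 2] leaves room above [c] for the strict inequality along the curve and is still
     negative. *)
  apply: (@le_lt_trans _ _ (c / 2)); last by rewrite ltr_pdivrMr// mul0r.
  apply: (hessian_lt (w := w) C2L gL0) => e e0.
  have c2 : c < c / 2 by rewrite ltr_pdivlMr// mulrDr; lra.
  have k0 : 0 < `|u| + `|w| + 1 by rewrite ltr_wpDl// addr_ge0.
  have e'0 : 0 < Num.min 1 (Num.min e (s / (`|u| + `|w| + 1))).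
    by rewrite lt_min ltr01 lt_min e0 divr_gt0.
  have [t [w' [/andP[t0] + w'w My fy]]] :=
    parabolic_subderivative_lt f_gtNy Mx0 fx0 d2 c2 e'0.
  rewrite lt_min => /andP[t1]; rewrite lt_min => /andP[te ts]; exists t, w';
    split => //; first by rewrite t0.
  set y := x0 + _ + _ in My fy *.
  have ys : `|y - x0| < s.
    have -> : y - x0 = t *: (u + (t / 2) *: w').
      by apply/rowP => i; rewrite /y !mxE; field.
    rewrite normrZ gtr0_norm// (le_lt_trans _
      (_ : t * (`|u| + `|w| + 1) < s))//.
      rewrite ler_pM2l// (le_trans (ler_normD _ _))//
        -addrA lerD2l normrZ gtr0_norm ?divr_gt0//.
      have w'1 : `|w'| <= `|w| + 1.
        by rewrite -(subrK w w') (le_trans (ler_normD _ _))// addrC lerD2l ltW.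
      by apply: le_trans w'1; rewrite ler_piMl//; lra.
    by rewrite -ltr_pdivlMr.
  have [fyF Gy] := MF y ys My.
  by rewrite !LF// -lte_fin EFinD -Fx0 -fyF.
have [c' c'0 [_ Pnear]] := P_lipschitz kappa_gt0 P_mono Px0.
pose r0 := Num.min s1 (Num.min s (s / c')).
have r0_gt0 : 0 < r0 by rewrite lt_min s1_gt0 lt_min s_gt0 divr_gt0.
have r0E x : `|x - x0| < r0 -> [/\ `|P x - x0| < s, M (P x) & `|x - x0| < s].
  rewrite lt_min => /andP[xs1]; rewrite lt_min => /andP[xs xc]; split =>
    //; last exact: PM.
  by rewrite (le_lt_trans (Pnear x))// mulrC -ltr_pdivlMr.
have [||B [dB Bsym Bpos Bu]] :=
  @P_strictly_diff _ d m P x0 mu kappa r0 L gL H G_ g_ K_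
  mu_gt0 kappa_gt0 r0_gt0 P_mono Px0 C2L gL0 C2K free.
- by move=> x /r0E[Pxs MPx _]; exact: (MF _ Pxs MPx).2.
- move=> x y /r0E[Pxs MPx _] /r0E[_ _ ys] Gy.
  have [fPx GPx] := MF _ Pxs MPx; have [_ fy] := GM y ys Gy.
  have := proxP f_gtNy f_proper f_closed f_wconvex rho_lt x y.
  by rewrite -/(P x) /prox_objective fPx fy !enorm_sqr -!EFinD lee_fin !LF.
exists B, u; split => //.
have {}Bu := Bu u (tanG u Gu).
set v := u + mu *: (u *m H) in Bu.
(* Since [v *m B = u], positivity on $v-u=\mu uH$ reads $\langle uB,u\rangle\ge\langle
   u,u\rangle-\mu\langle uH,u\rangle$. *)
have := Bpos (v - u).
rewrite mulmxBl Bu !dotBl !dotBr.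
have -> : dot (u *m B) v = dot u u by rewrite dotC dot_mulmxr Bsym Bu.
have -> : dot u v = dot u u + mu * dot (u *m H) u by rewrite dotDr dotZr
  (dotC u (u *m H)).
have : mu * dot (u *m H) u < 0 by rewrite pmulr_rlt0.
lra.
Qed.

End StrictSaddle.

(** * Limits of iterations *)

(** The radius is below [r / 2] and the centre is within half the radius of [x], so the cube
    contains [x] and lies within [r] of it. *)
Lemma exists_rational_cube (R : realType) d (x : 'rV[R]_d) (r : R) : 0 < r ->
  exists (q : 'rV[rat]_d) (n : nat), `|x - map_mx ratr q| < n.+1%:R^-1 /\
    forall y, `|y - map_mx ratr q| < n.+1%:R^-1 -> `|y - x| < r.
Proof.
move=> r0; pose n := Num.truncn (2 / r).
have n0 : 0 < n.+1%:R^-1 :> R by rewrite invr_gt0.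
have n2 : n.+1%:R^-1 < r / 2.
  by rewrite -[ltRHS]invrK ltf_pV2 ?posrE ?invr_gt0 ?divr_gt0//
    invf_div truncnS_gt.
have n1 : n.+1%:R^-1 / 2 < n.+1%:R^-1 :> R by rewrite ltr_pdivrMr// ltr_pMr//
  ltr1n.
have /choice[q Hq] : forall i : 'I_d, exists q : rat,
    `|x 0 i - ratr q| <= n.+1%:R^-1 / 2.
  move=> i; have [|q] := @rat_in_itvoo _ (x 0 i - n.+1%:R^-1 / 2)
    (x 0 i + n.+1%:R^-1 / 2).
    by rewrite ltrD2l gt0_cp// divr_gt0.
  rewrite in_itv/= => /andP[h1 h2]; exists q; move: h1 h2; rewrite ler_norml.
  by move: (ratr q : R) (_^-1 / 2) => z a; lra.
have xq : `|x - map_mx ratr (\row_i q i)| < n.+1%:R^-1.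
  apply: le_lt_trans n1; apply/rV_norm_leP => [|i]; first by rewrite divr_ge0//
    ltW.
  by rewrite !mxE.
exists (\row_i q i), n; split => // y yq.
rewrite (_ : y - x = (y - map_mx ratr (\row_i q i))
  - (x - map_mx ratr (\row_i q i))); last first.
  by rewrite opprB addrA subrK.
rewrite (le_lt_trans (ler_normB _ _))// (lt_trans (ltrD yq xq))//.
by move: n2; set a := _^-1; lra.
Qed.

Section Iteration.
Context {R : realType} {d : nat} (T : 'rV[R]_d -> 'rV[R]_d).
Implicit Types (x y : 'rV[R]_d).

Lemma iter_expanding (c : R) k x y : 0 <= c ->
  (forall x y, c * `|x - y| <= `|T x - T y|) ->
  c ^+ k * `|x - y| <= `|iter k T x - iter k T y|.
Proof.
move=> c0 Tc; elim: k => [|k IH]; first by rewrite mul1r.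
by rewrite exprS -mulrA (le_trans (ler_wpM2l c0 IH))//= Tc.
Qed.

Lemma lim_iter_fixed (C : R) x l : 0 <= C ->
  (forall x y, `|T x - T y| <= C * `|x - y|) ->
  (fun k => iter k T x) @ \oo --> l -> T l = l.
Proof.
move=> C0 TC xl; apply/eqP; rewrite -subr_eq0 -normr_le0.
apply/ler_addgt0Pr => e e0; rewrite add0r.
have e1 : 0 < e / (C + 1) by rewrite divr_gt0// ltr_wpDl.
have /cvgrPdist_lt/(_ _ e1)[K _ HK] := xl.
have h1 := HK K (leqnn K); have h2 := HK K.+1 (leqnSn K).
rewrite /= in h1 h2.
rewrite (_ : T l - l = (T l - T (iter K T x)) - (l - T (iter K T x)));
  last first.
  by rewrite opprB addrA subrK.
rewrite (le_trans (ler_normB _ _))// (le_trans (lerD (TC _ _) (lexx _)))//.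
have h3 := ler_wpM2l C0 (ltW h1).
have -> : e = C * (e / (C + 1)) + e / (C + 1) by field; rewrite gt_eqF//
  ltr_wpDl.
by rewrite lerD// ltW.
Qed.

(* Lindelof: the exceptional limit points are covered by countably many
   rational cubes, in each of which only a null set of points stays forever. *)
Lemma null_attracted (Z : set 'rV[R]_d) (c : R) : 0 < c ->
  (forall x y, c * `|x - y| <= `|T x - T y|) ->
  (forall z, Z z -> exists2 r : R, 0 < r &
    lebesgue_null [set y | forall k, `|iter k T y - z| < r]) ->
  lebesgue_null [set x | exists2 z, Z z & (fun k => iter k T x) @ \oo --> z].
Proof.
move=> c0 Tc Zr.
pose W (qn : 'rV[rat]_d * nat) := [set y : 'rV[R]_d |
  forall k, `|iter k T y - map_mx ratr qn.1| < qn.2.+1%:R^-1].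
apply: (@nullS _ _ _ (\bigcup_(qn in [set qn | lebesgue_null (W qn)])
  \bigcup_K [set x | W qn (iter K T x)])).
  move=> x [z /Zr[r r0 zr] xz].
  have [q [n [zq qn]]] := exists_rational_cube z r0.
  exists (q, n).
    by apply: nullS zr => y Wy k; apply: qn; exact: Wy.
  have e0 : 0 < n.+1%:R^-1 - `|z - map_mx ratr q| by rewrite subr_gt0.
  have /cvgrPdist_lt/(_ _ e0)[K _ HK] := xz.
  exists K => // k; rewrite -iterD.
  have := HK (k + K)%N (leq_addl _ _) => /= h.
  rewrite (_ : _ - _ = (z - map_mx ratr q) - (z - iter (k + K) T x));
    last first.
    by rewrite opprB [RHS]addrC addrA subrK.
  by rewrite (le_lt_trans (ler_normB _ _))// -ltrBrDl.
(* A convergent orbit enters such a cube for good at some time [K]; pulling back by [iter K T] keeps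
   null sets null. *)
apply: null_bigcup_count => qn Wqn; apply: null_bigcup => K _.
apply: (@null_expanding _ _ _ _ (iter K T) (c ^+ K)) Wqn; first
  exact: exprn_gt0.
  by move=> x y _ _; apply: iter_expanding => //; exact: ltW.
by [].
Qed.

End Iteration.

(** * The damped proximal iteration *)

Unset Implicit Arguments.

Theorem theorem3p2 (R : realType) (d : nat) (f : 'rV[R]_d -> \bar R)
    (rho mu alpha : R)
    (f_gtNy : forall x, f x != -oo%E)
    (f_proper : exists x, f x != +oo%E)
    (f_closed : closed_epigraph f)
    (rho_gt0 : 0 < rho)
    (f_wconvex : weakly_convex rho f)
    (f_saddle : strict_saddle_property f)
    (mu_bounds : 0 < mu < rho^-1)
    (alpha_bounds : 0 < alpha < Num.min 1 ((mu * rho)^-1 - 1)) :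
  lebesgue_almost_all (fun x0 : 'rV[R]_d =>
    forall xlim : 'rV[R]_d,
      damped_prox_iter mu alpha f x0 @ \oo --> xlim ->
      local_minimizer f xlim).
Proof.
have /andP[mu_gt0 mu_lt] := mu_bounds.
have rho_lt : rho < mu^-1 by rewrite -(invrK rho) ltf_pV2 ?posrE ?invr_gt0.
have /andP[a_gt0] := alpha_bounds; rewrite lt_min => /andP[a_lt1 _].
have a1_gt0 : 0 < 1 - alpha by rewrite subr_gt0.
pose P := prox mu f; pose T x := (1 - alpha) *: x + alpha *: P x.
pose kappa := mu * (mu^-1 - rho) / 2.
have kappa_gt0 : 0 < kappa by rewrite divr_gt0// mulr_gt0// subr_gt0.
have P_mono x y : kappa * dot (P x - P y) (P x - P y) <=
  dot (P x - P y) (x - y).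
  exact: prox_monotone.
(* Pairing [T x - T y] with [x - y] and dropping the nonnegative contribution of the monotone map
   [P] leaves $(1-\alpha)|x-y|^2$. *)
have T_expanding x y : (1 - alpha) / d.+1%:R * `|x - y| <= `|T x - T y|.
  have [->|w0] := eqVneq (x - y) 0; first by rewrite normr0 mulr0.
  have wp : 0 < `|x - y| by rewrite normr_gt0.
  have h1 : (1 - alpha) * `|x - y| ^+ 2 <= dot (T x - T y) (x - y).
    have -> : T x - T y = (1 - alpha) *: (x - y) + alpha *: (P x - P y).
      by apply/rowP => i; rewrite !mxE; ring.
    rewrite dotDl !dotZl; have h :=
      ler_wpM2l (ltW a1_gt0) (norm_sqr_le_dot (x - y)).
    apply: (le_trans h); rewrite lerDl mulr_ge0 ?(ltW a_gt0)//.
    by rewrite (le_trans _ (P_mono _ _))// mulr_ge0 ?dot_ge0// ltW.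
  have h2 := le_trans h1 (le_trans (ler_norm _) (dot_norm_le _ _)).
  rewrite mulrAC ler_pdivrMr// -(ler_pM2r wp); move: h2; rewrite expr2; lra.
have P_lip := monotone_lipschitz kappa_gt0 P_mono.
have T_lip x y : `|T x - T y| <= (1 + d.+1%:R / kappa) * `|x - y|.
  have -> : T x - T y = (1 - alpha) *: (x - y) + alpha *: (P x - P y).
    by apply/rowP => i; rewrite !mxE; ring.
  rewrite (le_trans (ler_normD _ _))//
    !normrZ (gtr0_norm a1_gt0) (gtr0_norm a_gt0).
  rewrite [leRHS]mulrDl lerD ?ler_wpM2r ?gerBl ?(ltW a_gt0)//.
  by rewrite (le_trans _ (P_lip x y))// ler_piMl// ltW.
(* Every limit of an exceptional orbit is a fixed point of [T] that is not a local minimizer. *)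
pose Z := [set z : 'rV[R]_d | T z = z /\ ~ local_minimizer f z].
apply: (@nullS _ _ _ [set x | exists2 z, Z z & (fun k => iter k T x) @ \oo -->
  z]).
  move=> x /existsNP[z /not_implyP[xz nmin]]; exists z => //; split => //.
  apply: lim_iter_fixed T_lip xz.
  by rewrite addr_ge0// divr_ge0// ltW.
apply: (null_attracted _ T_expanding); first by rewrite divr_gt0.
move=> z [Tz nmin].
have Pz : P z = z.
  have : alpha *: (P z - z) = T z - z by apply/rowP => i; rewrite !mxE; ring.
  by rewrite Tz subrr => /eqP; rewrite scaler_eq0 gt_eqF//= subr_eq0 => /eqP.
have crit : critical f z.
  have := prox_subdifferential f_gtNy f_proper f_closed f_wconvex mu_gt0 rho_lt
    z.
  by rewrite -/P Pz subrr scaler0.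
have [//|saddle] := f_saddle z crit.
have [B [u [dB Bsym Bpos Bu]]] :=
  strict_saddle_prox f_gtNy f_proper f_closed f_wconvex mu_gt0 rho_lt Pz saddle.
(* The derivative of [T] at [z] inherits symmetry and positivity from [B], and $\langle
   uB,u\rangle>\langle u,u\rangle$ survives averaging with the identity. *)
apply: (@null_never_escape _ _ T z ((1 - alpha) *: 1%:M + alpha *: B) u).
- by apply: strictly_diffD; apply: strictly_diffZ => //;
  exact: strictly_diff_id.
- by rewrite linearD !linearZ/= trmx1 Bsym.
- move=> w; rewrite mulmxDr -!scalemxAr mulmx1 dotDl !dotZl.
  by rewrite addr_ge0// mulr_ge0 ?dot_ge0 ?Bpos// ltW.
- rewrite mulmxDr -!scalemxAr mulmx1 dotDl !dotZl.
  have : alpha * dot u u < alpha * dot (u *m B) u by rewrite ltr_pM2l.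
  lra.
Qed.
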